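(* Let $M\subset\mathbb{R}^3$ be a smooth, compact surface, diffeomorphic to $S^2$, with positive Gauss curvature everywhere, and radially symmetric about the $x_3$-axis. If $f\in C^\infty(M)$ is a (real-valued) zonal function, then $u=J\nabla f$ is a stationary solution, for all $\Omega\in\mathbb{R}$, of the Euler equation $$\frac{\partial u}{\partial t}+\nabla_u u=\Omega\,\chi\,Ju-\nabla p,\qquad \operatorname{div}u=0;$$ that is, $\operatorname{div}u=0$ and for each $\Omega$ there is a scalar function $p$ on $M$ with $\nabla_u u=\Omega\chi Ju-\nabla p$.
   Context: $M$ carries the metric induced from $\mathbb{R}^3$. ''Radially symmetric about the $x_3$-axis'' means invariant under all rotations of $\mathbb{R}^3$ about the $x_3$-axis. $\nu(x)$ is the unit outward normal to $M$, $\chi(x)=e_3\cdot\nu(x)$ with $e_3=(0,0,1)$, $J:T_xM\to T_xM$ is counterclockwise rotation by $90^\circ$ (orientation given by $\nu$), $\nabla_u$ is the Levi-Civita covariant derivative along $u$. $X_3$ is the vector field on $M$ generating the $2\pi$-periodic rotation about the $x_3$-axis. A function $f\in C^\infty(M)$ is zonal if $X_3f=0$. *)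

(* Defs.v *)
From HB Require Import structures.
From mathcomp Require Import all_boot all_order all_algebra.
From mathcomp Require Import all_classical all_reals all_analysis.

Set Implicit Arguments.
Unset Strict Implicit.
Unset Printing Implicit Defensive.

Import Order.TTheory GRing.Theory Num.Theory.
Import numFieldNormedType.Exports.

Local Open Scope classical_set_scope.
Local Open Scope ring_scope.

Fixpoint Ck (R : realType) (V W : normedModType R) (k : nat) (U : set V)
    (f : V -> W) : Prop :=
  match k with
  | 0%N => forall x, U x -> {for x, continuous f}
  | k'.+1 => (forall x, U x -> differentiable f x) /\
             (forall v : V, Ck k' U (fun x => 'D_v f x))
  end.

(* Meant for open U only; see [smooth_map] for other domains. *)
Definition smooth (R : realType) (V W : normedModType R) (U : set V)
    (f : V -> W) : Prop :=
  forall k, Ck k U f.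

(* Smoothness on an arbitrary subset A of V: near every point of A, f agrees
   on A with a smooth function on an open subset of V.  Values of f outside A
   are irrelevant. *)
Definition smooth_map (R : realType) (V W : normedModType R) (A : set V)
    (f : V -> W) : Prop :=
  forall x, A x -> exists (U : set V) (F : V -> W),
    [/\ open U, U x, smooth U F & forall y, A y -> U y -> F y = f y].

Definition diffeomorphic (R : realType) (V W : normedModType R)
    (A : set V) (B : set W) : Prop :=
  exists (phi : V -> W) (psi : W -> V),
    [/\ smooth_map A phi /\ smooth_map B psi,
        (forall x, A x -> B (phi x)) /\ (forall y, B y -> A (psi y)),
        forall x, A x -> psi (phi x) = x &
        forall y, B y -> phi (psi y) = y].

Definition smooth_surface (R : realType) (M : set 'rV[R]_3) : Prop :=
  forall x, M x -> exists (V : set 'rV[R]_3) (U : set 'rV[R]_2),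
    [/\ open V, V x, open U & diffeomorphic (M `&` V) U].

(* The Euclidean inner product; the library norm on 'rV[R]_n is the sup norm
   and is used here only through the topology and boundedness it defines. *)
Definition dot (R : realType) (n : nat) (v w : 'rV[R]_n) : R :=
  (v *m w^T) 0 0.

Definition vec3 (R : realType) (a b c : R) : 'rV[R]_3 :=
  \row_(i < 3) [:: a; b; c]`_i.

Definition cross (R : realType) (v w : 'rV[R]_3) : 'rV[R]_3 :=
  vec3 (v 0 1 * w 0 2 - v 0 2 * w 0 1)
       (v 0 2 * w 0 0 - v 0 0 * w 0 2)
       (v 0 0 * w 0 1 - v 0 1 * w 0 0).

Definition sphere2 (R : realType) : set 'rV[R]_3 := [set x | dot x x = 1].

Definition rot3 (R : realType) (t : R) (x : 'rV[R]_3) : 'rV[R]_3 :=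
  vec3 (cos t * x 0 0 - sin t * x 0 1)
       (sin t * x 0 0 + cos t * x 0 1)
       (x 0 2).

Definition radially_symmetric (R : realType) (M : set 'rV[R]_3) : Prop :=
  forall t : R, rot3 t @` M = M.

Definition X3 (R : realType) (x : 'rV[R]_3) : 'rV[R]_3 :=
  derive1 (fun t : R => rot3 t x) 0.

(* c is a smooth curve in M, defined near 0, with c(0) = x and c'(0) = v. *)
Definition curve_at (R : realType) (M : set 'rV[R]_3) (x v : 'rV[R]_3)
    (c : R -> 'rV[R]_3) : Prop :=
  (exists I : set R, [/\ open I, I 0, smooth I c &
                         forall t, I t -> M (c t)]) /\
  c 0 = x /\ derive1 c 0 = v.

Definition tangent (R : realType) (M : set 'rV[R]_3) (x : 'rV[R]_3) :
    set 'rV[R]_3 :=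
  [set v | exists c, curve_at M x v c].

(* The differential of g : M -> W at x in the tangent direction v, that is
   (g o c)'(0) for a curve c in M with c(0) = x and c'(0) = v.  For x in M,
   v tangent and g smooth on M it exists and does not depend on c; it is only
   meaningful there. *)
Definition dM (R : realType) (W : normedModType R) (M : set 'rV[R]_3)
    (g : 'rV[R]_3 -> W) (x v : 'rV[R]_3) : W :=
  xget 0 [set d | exists2 c, curve_at M x v c &
                  is_derive (0 : R) (1 : R) (g \o c) d].

Definition grad (R : realType) (M : set 'rV[R]_3) (g : 'rV[R]_3 -> R)
    (x : 'rV[R]_3) : 'rV[R]_3 :=
  xget 0 [set w | tangent M x w /\
                  forall v, tangent M x v -> dot w v = dM M g x v].

(* The points of the complement of M that lie in an unbounded component. *)
Definition exterior (R : realType) (M : set 'rV[R]_3) : set 'rV[R]_3 :=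
  [set y | (~` M) y /\ ~ bounded_set (connected_component (~` M) y)].

Definition outward_unit_normal (R : realType) (M : set 'rV[R]_3)
    (nu : 'rV[R]_3 -> 'rV[R]_3) : Prop :=
  smooth_map M nu /\
  forall x, M x ->
    [/\ dot (nu x) (nu x) = 1,
        forall v, tangent M x v -> dot (nu x) v = 0 &
        \forall t \near (0 : R)^'+, exterior M (x + t *: nu x)].

(* Rotation by a right angle in the tangent plane at x, counterclockwise when
   seen from the tip of nu x: (v, J v, nu x) is positively oriented. *)
Definition rotJ (R : realType) (nu : 'rV[R]_3 -> 'rV[R]_3)
    (x v : 'rV[R]_3) : 'rV[R]_3 :=
  cross (nu x) v.

Definition chi (R : realType) (nu : 'rV[R]_3 -> 'rV[R]_3) (x : 'rV[R]_3) : R :=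
  dot (vec3 0 0 1) (nu x).

(* The rows of e are an orthonormal basis of the tangent plane at x. *)
Definition orthonormal_frame (R : realType) (M : set 'rV[R]_3)
    (x : 'rV[R]_3) (e : 'M[R]_(2, 3)) : Prop :=
  (forall i, tangent M x (row i e)) /\ e *m e^T = 1%:M.

(* The matrix of an endomorphism L of the tangent plane at x in some
   orthonormal basis; only its trace and determinant, which do not depend on
   the basis, are used. *)
Definition tangent_mx (R : realType) (M : set 'rV[R]_3) (x : 'rV[R]_3)
    (L : 'rV[R]_3 -> 'rV[R]_3) : 'M[R]_2 :=
  let e := xget 0 (orthonormal_frame M x) in
  \matrix_(i, j) dot (L (row i e)) (row j e).

(* The determinant of the differential of the Gauss map. *)
Definition gauss_curvature (R : realType) (M : set 'rV[R]_3)
    (nu : 'rV[R]_3 -> 'rV[R]_3) (x : 'rV[R]_3) : R :=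
  \det (tangent_mx M x (dM M nu x)).

Definition vector_field (R : realType) (M : set 'rV[R]_3)
    (X : 'rV[R]_3 -> 'rV[R]_3) : Prop :=
  smooth_map M X /\ forall x, M x -> tangent M x (X x).

(* [nabla Y x v] is the covariant derivative of the field Y at x along v. *)
Definition affine_connection (R : realType) (M : set 'rV[R]_3)
    (nabla : ('rV[R]_3 -> 'rV[R]_3) -> 'rV[R]_3 -> 'rV[R]_3 -> 'rV[R]_3) :
    Prop :=
  [/\ (forall X Y, vector_field M X -> vector_field M Y ->
         vector_field M (fun x => nabla Y x (X x))),
      (forall Y x (a : R) v w, vector_field M Y -> M x ->
         tangent M x v -> tangent M x w ->
         nabla Y x (a *: v + w) = a *: nabla Y x v + nabla Y x w),
      (forall Y Z x v, vector_field M Y -> vector_field M Z -> M x ->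
         tangent M x v ->
         nabla (fun y => Y y + Z y) x v = nabla Y x v + nabla Z x v) &
      (forall (h : 'rV[R]_3 -> R) Y x v,
         smooth_map M h -> vector_field M Y -> M x ->
         tangent M x v ->
         nabla (fun y => h y *: Y y) x v =
           dM M h x v *: Y x + h x *: nabla Y x v)].

(* nabla_X Y - nabla_Y X = [X, Y], both sides acting as derivations on
   smooth functions h, where [X, Y] h = X (Y h) - Y (X h). *)
Definition torsion_free (R : realType) (M : set 'rV[R]_3)
    (nabla : ('rV[R]_3 -> 'rV[R]_3) -> 'rV[R]_3 -> 'rV[R]_3 -> 'rV[R]_3) :
    Prop :=
  forall X Y (h : 'rV[R]_3 -> R) x,
    vector_field M X -> vector_field M Y -> smooth_map M h ->
    M x ->
    dM M h x (nabla Y x (X x) - nabla X x (Y x)) =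
      dM M (fun y => dM M h y (Y y)) x (X x)
      - dM M (fun y => dM M h y (X y)) x (Y x).

Definition metric_compatible (R : realType) (M : set 'rV[R]_3)
    (nabla : ('rV[R]_3 -> 'rV[R]_3) -> 'rV[R]_3 -> 'rV[R]_3 -> 'rV[R]_3) :
    Prop :=
  forall Y Z x v,
    vector_field M Y -> vector_field M Z -> M x -> tangent M x v ->
    dM M (fun y => dot (Y y) (Z y)) x v =
      dot (nabla Y x v) (Z x) + dot (Y x) (nabla Z x v).

(* The metric is the one induced from the ambient space.  These axioms
   determine [nabla Y x v] for smooth Y, x in M and v tangent. *)
Definition levi_civita (R : realType) (M : set 'rV[R]_3)
    (nabla : ('rV[R]_3 -> 'rV[R]_3) -> 'rV[R]_3 -> 'rV[R]_3 -> 'rV[R]_3) :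
    Prop :=
  [/\ affine_connection M nabla, torsion_free M nabla &
      metric_compatible M nabla].

(* The trace of v |-> nabla_v u. *)
Definition divergence (R : realType) (M : set 'rV[R]_3)
    (nabla : ('rV[R]_3 -> 'rV[R]_3) -> 'rV[R]_3 -> 'rV[R]_3 -> 'rV[R]_3)
    (u : 'rV[R]_3 -> 'rV[R]_3) (x : 'rV[R]_3) : R :=
  \tr (tangent_mx M x (nabla u x)).

Definition zonal (R : realType) (M : set 'rV[R]_3) (f : 'rV[R]_3 -> R) : Prop :=
  forall x, M x -> dM M f x (X3 x) = 0.

(* Main.v *)
Require Import Defs.
From HB Require Import structures.
From mathcomp Require Import all_boot all_order all_algebra.
From mathcomp Require Import all_classical all_reals all_analysis.
From mathcomp Require Import ring lra.
Import Order.TTheory GRing.Theory Num.Theory.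
Import numFieldNormedType.Exports.
Local Open Scope classical_set_scope.
Local Open Scope ring_scope.
(**
Write D_v Y = [dM M Y x v] for the componentwise derivative of a field Y along
a tangent vector v, G for the gradient of f, and K for the field e3 x y that
generates the rotations; K is tangent to M because M is radially symmetric.

Besides the smoothness of nabla_u u, two facts are used about the connection.
By the Koszul argument the axioms of [levi_civita] force nabla_v Y to be the
tangential part of D_v Y ([nablaE]).  Since moreover
D_X Y - D_Y X = nabla_X Y - nabla_Y X is tangent, the shape operator is
symmetric ([shape_sym]), and so is the Hessian of every smooth function
([hessian_sym]).

Divergence.  The divergence of u = nu x G is, in an orthonormal frame (a, b) of
the tangent plane, up to sign the difference of the two mixed entries of the
Hessian of f ([divergence_stream]).

Curl.  A pressure exists as soon as W = Omega chi Ju - nabla_u u is a gradient.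
Its curl vanishes, in the sense that <D_v W, w> is symmetric in v and w
([curl_free_at]):
- Ju = - G, and chi and f are both annihilated by K, so d chi and df are
  parallel wherever K is nonzero, because the tangent plane is
  two-dimensional; hence chi G has no curl there.
- Zonality of f gives |K|^2 u = s K with s = <u, K>, and s is zonal as well
  ([dM_momentum_rotation]).  Differentiating this identity along u yields
  |K|^4 nabla_u u = s^2 B, where B is the tangential part of K (K y)
  ([accelE]).  As B is minus half the gradient of |K|^2, all the differentials
  in this identity are again parallel, and nabla_u u has no curl where K is
  nonzero ([accel_curl_free]).
- The zeros of K on M are the poles.  They are limits of points where K is
  nonzero, and the curl is continuous ([curl_free_closure]).

Exactness.  Let psi : S^2 -> M be the given diffeomorphism.  Pulling W back by
y |-> psi (y / |y|) gives a 1-form on R^3 minus the origin, closed by the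
symmetry of second derivatives ([schwarz]).  It has a potential P: one on each
of two slit spaces, star-shaped about opposite points ([poincare_star]), and
these two differ by a constant on the connected intersection
([poincare_punctured]).  Composing P with the inverse diffeomorphism M -> S^2
gives the pressure ([curl_free_exact]).  Working in R^3 minus the origin rather
than in charts of the sphere makes all derivatives ordinary ones.
*)

Set Implicit Arguments.
Unset Strict Implicit.
Unset Printing Implicit Defensive.

(** * The Euclidean inner product *)

Section InnerProduct.
Variable R : realType.

Lemma dotE n (v w : 'rV[R]_n) : dot v w = \sum_(i < n) v 0 i * w 0 i.
Proof. by rewrite /dot mxE; apply: eq_bigr => i _; rewrite mxE. Qed.

Lemma dotC n (a b : 'rV[R]_n) : dot a b = dot b a.
Proof. by rewrite !dotE; apply: eq_bigr => i _; rewrite mulrC. Qed.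

Lemma dotDl n (a b c : 'rV[R]_n) : dot (a + b) c = dot a c + dot b c.
Proof. by rewrite /dot mulmxDl mxE. Qed.

Lemma dotDr n (a b c : 'rV[R]_n) : dot c (a + b) = dot c a + dot c b.
Proof. by rewrite dotC dotDl !(dotC c). Qed.

Lemma dotZl n k (a b : 'rV[R]_n) : dot (k *: a) b = k * dot a b.
Proof. by rewrite /dot -scalemxAl mxE. Qed.

Lemma dotZr n k (a b : 'rV[R]_n) : dot a (k *: b) = k * dot a b.
Proof. by rewrite dotC dotZl dotC. Qed.

Lemma dotNl n (a b : 'rV[R]_n) : dot (- a) b = - dot a b.
Proof. by rewrite -scaleN1r dotZl mulN1r. Qed.

Lemma dotNr n (a b : 'rV[R]_n) : dot a (- b) = - dot a b.
Proof. by rewrite dotC dotNl dotC. Qed.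

Lemma dotBl n (a b c : 'rV[R]_n) : dot (a - b) c = dot a c - dot b c.
Proof. by rewrite dotDl dotNl. Qed.

Lemma dotBr n (a b c : 'rV[R]_n) : dot c (a - b) = dot c a - dot c b.
Proof. by rewrite dotDr dotNr. Qed.

Lemma dot0l n (a : 'rV[R]_n) : dot 0 a = 0.
Proof. by rewrite -(scale0r 0) dotZl mul0r. Qed.

Lemma dot0r n (a : 'rV[R]_n) : dot a 0 = 0.
Proof. by rewrite dotC dot0l. Qed.

Lemma dot_self_ge0 n (y : 'rV[R]_n) : 0 <= dot y y.
Proof. by rewrite dotE sumr_ge0 // => i _; rewrite -expr2 sqr_ge0. Qed.

Lemma dot_self_eq0 n (a : 'rV[R]_n) : dot a a = 0 -> a = 0.
Proof.
rewrite dotE => /eqP; rewrite psumr_eq0; last by move=> i _; rewrite -expr2 sqr_ge0.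
move=> /allP H; apply/rowP => i; rewrite mxE.
have := H i (mem_index_enum i).
by rewrite /= mulf_eq0 orbb => /eqP.
Qed.

Lemma dot_self_gt0 n (y : 'rV[R]_n) : y != 0 -> 0 < dot y y.
Proof.
move=> y0; rewrite lt_neqAle dot_self_ge0 andbT eq_sym.
by apply: contra y0 => /eqP /dot_self_eq0 ->.
Qed.

Lemma coord_le_norm n (x : 'rV[R]_n) i : `|x 0 i| <= `|x|.
Proof.
rewrite [in leRHS]/Num.Def.normr /= mx_normrE.
exact: (le_bigmax _ (fun ij => `|x ij.1 ij.2|) (0, i)).
Qed.

Lemma dot_le n (a b : 'rV[R]_n) : `|dot a b| <= (\sum_(i < n) `|a 0 i|) * `|b|.
Proof.
rewrite dotE mulr_suml; apply: (le_trans (ler_norm_sum _ _ _)).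
by apply: ler_sum => i _; rewrite normrM ler_wpM2l // coord_le_norm.
Qed.

Lemma coord_linear n (i : 'I_n) : linear (fun x : 'rV[R]_n => x 0 i : R).
Proof. by move=> a x y; rewrite !mxE. Qed.

(** Coordinates and inner products are bundled as linear maps only where a
lemma on continuous linear maps is applied to them. *)
Definition coordl n (i : 'I_n) : {linear 'rV[R]_n -> R} :=
  HB.pack (fun x : 'rV[R]_n => x 0 i : R)
    (GRing.isLinear.Build R 'rV[R]_n R *:%R _ (@coord_linear n i)).

Lemma coordl_continuous n (i : 'I_n) : continuous (@coordl n i).
Proof. exact: coord_continuous. Qed.

Lemma dot_linear n (a : 'rV[R]_n) : linear (dot a).
Proof. by move=> k x y; rewrite dotDr dotZr. Qed.

Definition dotf n (a : 'rV[R]_n) : {linear 'rV[R]_n -> R} :=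
  HB.pack (dot a) (GRing.isLinear.Build R 'rV[R]_n R *:%R _ (dot_linear a)).

Lemma dotf_continuous n (a : 'rV[R]_n) : continuous (dotf a).
Proof.
have E : (dotf a : 'rV[R]_n -> R) = \sum_(i < n) (fun b : 'rV[R]_n => a 0 i *: coordl i b).
  by rewrite funeqE => b; rewrite fct_sumE /= dotE.
move=> x; rewrite E; apply: differentiable_continuous.
apply: differentiable_sum => i; apply: differentiableZ.
exact: differentiable_coord.
Qed.

End InnerProduct.

(** * Calculus of functions of class C^k *)

Section ScaleDiff.
Variables (R : realType) (V W : normedModType R).

Lemma scale_is_bilinear :
  bilinear_for
    (GRing.Scale.Law.clone _ _ ( *:%R ) _) (GRing.Scale.Law.clone _ _ ( *:%R ) _)
    (@GRing.scale R W : R -> W -> W).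
Proof.
by split=> [u|u] a x y /=; [rewrite scalerDl scalerA | rewrite scalerDr !scalerA mulrC].
Qed.

Lemma is_diff_scale (a da : V -> R) (h dh : V -> W) x :
  is_diff x a da -> is_diff x h dh ->
  is_diff x (fun y => a y *: h y) (fun v => da v *: h x + a x *: dh v).
Proof.
move=> dax dhx.
pose B := bilinear_isBilinear.Build R R W W _ _ _ scale_is_bilinear.
pose b : {bilinear R -> W -> W} := HB.pack (@GRing.scale R W : R -> W -> W) B.
have bc : continuous (fun p => b p.1 p.2).
  by move=> p; apply: cvgZ; [exact: cvg_fst | exact: cvg_snd].
have db : is_diff (a x, h x) (fun p => b p.1 p.2)
    (fun q => b (a x) q.2 + b q.1 (h x)).
  by apply: DiffDef; [exact: differentiable_bilin | rewrite diff_bilin].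
have := is_diff_comp (is_diff_pair dax dhx) db.
move=> H; apply: is_diff_eq H _.
by rewrite funeqE => v /=; rewrite addrC.
Qed.

End ScaleDiff.

Section CkCalculus.
Variable R : realType.
Implicit Types V W : normedModType R.

Lemma near_open V (U : set V) x : open U -> U x -> \forall y \near x, U y.
Proof. by move=> oU Ux; apply: open_nbhs_nbhs. Qed.

(** A form of differentiability without Landau symbols, convenient both for
transporting differentiability between functions that agree locally and for
proving it from estimates. *)
Lemma is_diffP_eps V W (f : V -> W) (L : {linear V -> W}) x : continuous L ->
  (forall e, 0 < e -> \forall h \near 0, `|f (h + x) - f x - L h| <= e * `|h|) <->
  is_diff x f L.
Proof.
move=> Lc; split=> [H|H].
  have E : f \o shift x = cst (f x) + L +o_ 0 id.
    apply/eqaddoP => e e0; have := H _ e0.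
    by apply: filterS => h; rewrite !fctE /= opprD addrA.
  have dE : 'd f x = L :> (V -> W) by exact: diff_unique E.
  by apply: DiffDef => //; apply/diff_locallyP; rewrite dE.
move=> e e0.
have df : differentiable f x by exact: ex_diff.
have /diff_locallyP[_ /eqaddoP/(_ e e0)] := df.
by apply: filterS => h; rewrite diff_val !fctE /= opprD addrA.
Qed.

Lemma is_diff_near V W (f g : V -> W) (x : V) :
  (\forall y \near x, f y = g y) -> differentiable f x ->
  is_diff x g ('d f x).
Proof.
move=> fg df.
have fgx : f x = g x by exact: nbhs_singleton fg.
have c := diff_continuous df.
apply/is_diffP_eps => // e e0.
have /is_diffP_eps -/(_ c e e0) H : is_diff x f ('d f x) by exact: differentiableP.
have fg0 : \forall h \near 0, f (h + x) = g (h + x).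
  move: fg; rewrite (near_shift 0 x) subr0 => fg; exact: fg.
by apply: filterS2 fg0 H => h <- ; rewrite fgx.
Qed.


Lemma Ck_eq V W k (U : set V) (f g : V -> W) : open U ->
  (forall x, U x -> f x = g x) -> Ck k U f -> Ck k U g.
Proof.
move=> oU; elim: k f g => [|k IH] f g fg /=.
  move=> cf x Ux; have nfg : \forall y \near x, f y = g y.
    by apply: (@filterS _ _ _ U) => //; exact: near_open.
  have cfx : f x @[x --> x] --> f x by exact: cf.
  suff : g x @[x --> x] --> g x by [].
  by rewrite -(fg _ Ux); apply: cvg_trans cfx; apply: near_eq_cvg; apply: filterS nfg => y ->.
move=> [df Cf]; split=> [x Ux|v].
  have nfg : \forall y \near x, f y = g y by apply: (@filterS _ _ _ U) => //; exact: near_open.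
  by have [] := is_diff_near nfg (df _ Ux).
apply: IH (Cf v) => x Ux; apply: near_eq_derive.
by apply: (@filterS _ _ _ U) => //; exact: near_open.
Qed.

Lemma CkW V W k (U : set V) (f : V -> W) : Ck k.+1 U f -> Ck k U f.
Proof.
elim: k f => [|k IH] f [df Cf].
  by move=> x Ux; apply: differentiable_continuous; exact: df.
by split=> // v; apply: IH; exact: Cf.
Qed.

Lemma Ck_sub V W k (U U' : set V) (f : V -> W) : U' `<=` U ->
  Ck k U f -> Ck k U' f.
Proof.
move=> UU; elim: k f => [|k IH] f /=; first by move=> cf x /UU; exact: cf.
by move=> [df Cf]; split=> [x /UU|v]; [exact: df | exact: IH].
Qed.

(** The hypothesis asks for no openness: the condition defining [Ck] is
pointwise, being stated with full derivatives in the ambient space. *)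
Lemma Ck_local V W k (U : set V) (f : V -> W) :
  (forall x, U x -> exists2 U', U' x & Ck k U' f) -> Ck k U f.
Proof.
elim: k f => [|k IH] f H /=.
  by move=> x /H [U' U'x]; apply.
split.
  by move=> x /H [U' U'x [dU _]]; exact: dU.
move=> v.
by apply: IH => x /H [U' U'x [_ Cf]]; exists U' => //; exact: Cf.
Qed.

Lemma Ck_cst V W k (U : set V) (c : W) : Ck k U (fun _ => c).
Proof.
elim: k c => [|k IH] c /=; first by move=> x _; exact: cvg_cst.
split=> [x _|v]; first exact: differentiable_cst.
rewrite (_ : (fun x => 'D_v _ x) = fun _ => 0); first exact: IH.
by rewrite funeqE => x; rewrite [LHS](@derive_cst _ _ _ c).
Qed.

Lemma Ck_lin V W k (U : set V) (L : {linear V -> W}) : continuous L -> Ck k U L.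
Proof.
move=> Lc; case: k => [|k] /=; first by move=> x _; exact: Lc.
split=> [x _|v]; first exact: linear_differentiable.
rewrite (_ : (fun x => 'D_v _ x) = fun _ => L v); first exact: Ck_cst.
rewrite funeqE => x; rewrite deriveE ?diff_lin //.
exact: linear_differentiable.
Qed.

Lemma CkD V W k (U : set V) (f g : V -> W) : open U ->
  Ck k U f -> Ck k U g -> Ck k U (fun x => f x + g x).
Proof.
move=> oU; elim: k f g => [|k IH] f g /=.
  by move=> cf cg x Ux; apply: cvgD; [exact: cf | exact: cg].
move=> [df Cf] [dg Cg]; split=> [x Ux|v].
  by apply: differentiableD; [exact: df | exact: dg].
apply: (Ck_eq oU _ (IH _ _ (Cf v) (Cg v))) => x Ux.
by rewrite -deriveD //; apply: diff_derivable; [exact: df | exact: dg].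
Qed.

Lemma derive_scale V W (a : V -> R) (f : V -> W) x v :
  differentiable a x -> differentiable f x ->
  'D_v (fun x => a x *: f x) x = 'D_v a x *: f x + a x *: 'D_v f x.
Proof.
move=> da df.
have D := is_diff_scale (differentiableP da) (differentiableP df).
by rewrite !deriveE // ?diff_val //; exact: ex_diff.
Qed.

Lemma differentiable_scale V W (a : V -> R) (f : V -> W) x :
  differentiable a x -> differentiable f x ->
  differentiable (fun x => a x *: f x) x.
Proof.
move=> da df.
by have [] := is_diff_scale (differentiableP da) (differentiableP df).
Qed.

(** The derivative of a product is a sum of products of C^k functions, one
factor of which has lost a derivative; [CkW] brings all factors to the same
class. *)
Lemma CkZ V W k (U : set V) (a : V -> R) (f : V -> W) : open U ->
  Ck k U a -> Ck k U f -> Ck k U (fun x => a x *: f x).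
Proof.
move=> oU; elim: k a f => [|k IH] a f /=.
  by move=> ca cf x Ux; apply: cvgZ; [exact: ca | exact: cf].
move=> Ca1 Cf1; have [da Ca] := Ca1; have [df Cf] := Cf1; split=> [x Ux|v].
  by apply: differentiable_scale; [exact: da | exact: df].
have C1 := IH _ _ (Ca v) (CkW Cf1).
have C2 := IH _ _ (CkW Ca1) (Cf v).
apply: (Ck_eq oU _ (CkD oU C1 C2)) => x Ux.
by rewrite derive_scale //; [exact: da | exact: df].
Qed.

Lemma Ck_sum V W k (U : set V) n (f : 'I_n -> V -> W) : open U ->
  (forall i, Ck k U (f i)) -> Ck k U (fun x => \sum_(i < n) f i x).
Proof.
move=> oU; elim: n f => [|n IH] f Cf.
  by under eq_fun do rewrite big_ord0; exact: Ck_cst.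
under eq_fun do rewrite big_ord_recr.
by apply: CkD => //; apply: IH.
Qed.

Lemma derive_coord V n (f : V -> 'rV[R]_n) x v i :
  differentiable f x -> 'D_v (fun x => f x 0 i) x = ('D_v f x) 0 i.
Proof.
move=> df; rewrite (derive_mx (diff_derivable df)) mxE //.
Qed.

Lemma differentiable_coordP V n (f : V -> 'rV[R]_n) x :
  differentiable f x <-> forall i, differentiable (fun x => f x 0 i) x.
Proof.
split=> [df i|df].
  exact: (differentiable_comp (g := fun N : 'rV[R]_n => N 0 i) df (differentiable_coord _ _ _)).
pose F (i : 'I_n) y := f y 0 i *: (delta_mx 0 i : 'rV[R]_n).
have -> : f = \sum_(i < n) F i.
  by rewrite funeqE => y; rewrite fct_sumE; exact: row_sum_delta.
by apply: differentiable_sum => i; apply: differentiableZl; exact: df.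
Qed.

(** Stated for open sets because the backward direction replaces a function by
the sum of its coordinates, and [Ck] sees a neighbourhood of each point. *)
Lemma Ck_coordP V k (U : set V) n (f : V -> 'rV[R]_n) : open U ->
  Ck k U f <-> forall i, Ck k U (fun x => f x 0 i).
Proof.
move=> oU; split=> [Cf i|Cf].
  elim: k f Cf => [|k IH] f /=.
    move=> cf x Ux.
    exact: (continuous_comp (g := fun N : 'rV[R]_n => N 0 i) (cf _ Ux) (@coord_continuous _ _ _ _ _ _)).
  move=> [df Cf]; split=> [x Ux|v].
    exact: (differentiable_coordP _ _).1 (df _ Ux) i.
  apply: (Ck_eq oU _ (IH _ (Cf v))) => x Ux.
  by rewrite derive_coord //; exact: df.
apply: (@Ck_eq _ _ _ _ (fun x => \sum_(i < n) f x 0 i *: delta_mx 0 i)) => //.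
  by move=> x _; rewrite -row_sum_delta.
apply: (@Ck_sum _ _ k U n (fun i x => f x 0 i *: delta_mx 0 i) oU) => i.
by apply: CkZ => //; exact: Ck_cst.
Qed.

(** Turns the derivative of a composite into products of coordinates and of
fixed directional derivatives, to which [CkZ] and [Ck_sum] apply. *)
Lemma derive_basis n W (g : 'rV[R]_n -> W) y v : differentiable g y ->
  'D_v g y = \sum_(i < n) v 0 i *: 'D_(delta_mx 0 i) g y.
Proof.
move=> dg; rewrite deriveE // {1}(row_sum_delta v) linear_sum.
by apply: eq_bigr => i _; rewrite linearZ deriveE.
Qed.

Lemma derive_comp V W n (f : V -> 'rV[R]_n) (g : 'rV[R]_n -> W) x v :
  differentiable f x -> differentiable g (f x) ->
  'D_v (g \o f) x = 'D_('D_v f x) g (f x).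
Proof.
move=> df dg; rewrite [LHS]deriveE; last exact: differentiable_comp.
by rewrite diff_comp // !deriveE.
Qed.

(** The intermediate space has finite dimension, so that D_v (g o f) is the sum
of the (D_v f)_i times (D_i g) o f, and induction on k applies to D_i g. *)
Lemma Ck_comp V W k (U : set V) n (U' : set 'rV[R]_n) (f : V -> 'rV[R]_n)
  (g : 'rV[R]_n -> W) : open U -> (forall x, U x -> U' (f x)) ->
  Ck k U f -> Ck k U' g -> Ck k U (g \o f).
Proof.
move=> oU fU; elim: k W g => [|k IH] W g.
  move=> cf cg x Ux; apply: continuous_comp; first exact: cf.
  by apply: cg; exact: fU.
move=> Cf1 Cg1; have [df Cf] := Cf1; have [dg Cg] := Cg1; split=> [x Ux|v].
  by apply: differentiable_comp; [exact: df | apply: dg; exact: fU].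
apply: (@Ck_eq _ _ _ _ (fun x => \sum_(i < n)
  ('D_v f x) 0 i *: ((fun y => 'D_(delta_mx 0 i) g y) \o f) x)) => //.
  move=> x Ux; rewrite derive_comp; [|exact: df|by apply: dg; exact: fU].
  by rewrite derive_basis //; apply: dg; exact: fU.
apply: (@Ck_sum _ _ _ _ _ (fun i x =>
  ('D_v f x) 0 i *: ((fun y => 'D_(delta_mx 0 i) g y) \o f) x) oU) => i.
apply: CkZ => //; first exact: (Ck_coordP _ _ oU).1 (Cf v) i.
by apply: IH; [exact: CkW | exact: Cg].
Qed.

End CkCalculus.

(** * Smooth maps on arbitrary subsets *)

Section SmoothMaps.
Variable R : realType.
Implicit Types V W : normedModType R.

Lemma smooth_map_eq V W (A : set V) (f g : V -> W) :
  (forall x, A x -> f x = g x) -> smooth_map A f -> smooth_map A g.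
Proof.
move=> fg sf x Ax; have [U [F [oU Ux sF Ff]]] := sf _ Ax.
by exists U, F; split=> // y Ay Uy; rewrite Ff // fg.
Qed.

Lemma smooth_smooth_map V W (A U : set V) (f : V -> W) :
  open U -> A `<=` U -> smooth U f -> smooth_map A f.
Proof. by move=> oU AU sf x /AU Ux; exists U, f; split. Qed.

(** On an open set the extrinsic notion of smoothness agrees with the one by
iterated derivatives. *)
Lemma smooth_map_open V W (U : set V) (f : V -> W) :
  open U -> smooth_map U f -> smooth U f.
Proof.
move=> oU sf k; apply: Ck_local => x Ux.
have [U' [F [oU' U'x sF Ff]]] := sf _ Ux.
have oUU' : open (U `&` U') by exact: openI.
exists (U `&` U') => //; apply: (@Ck_eq _ _ _ _ _ F) => //.
  by move=> y [Uy U'y]; exact: Ff.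
by apply: Ck_sub (sF k) => y [].
Qed.

Lemma smooth_map_cst V W (A : set V) (c : W) : smooth_map A (fun _ => c).
Proof.
apply: (@smooth_smooth_map _ _ _ setT) => //; first exact: openT.
by move=> k; exact: Ck_cst.
Qed.

Lemma smooth_map_lin V W (A : set V) (L : {linear V -> W}) :
  continuous L -> smooth_map A L.
Proof.
move=> Lc; apply: (@smooth_smooth_map _ _ _ setT) => //; first exact: openT.
by move=> k; exact: Ck_lin.
Qed.

Lemma smooth_map_id V (A : set V) : smooth_map A id.
Proof. by apply: (@smooth_map_lin _ _ A idfun) => x. Qed.

Lemma smooth_mapD V W (A : set V) (f g : V -> W) :
  smooth_map A f -> smooth_map A g -> smooth_map A (fun x => f x + g x).
Proof.
move=> sf sg x Ax; have [U [F [oU Ux sF Ff]]] := sf _ Ax.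
have [U' [G [oU' U'x sG Gg]]] := sg _ Ax.
have o : open (U `&` U') by exact: openI.
exists (U `&` U'), (fun x => F x + G x); split=> //.
  by move=> k; apply: CkD => //; [apply: Ck_sub (sF k)|apply: Ck_sub (sG k)] => y [].
by move=> y Ay [Uy U'y]; rewrite Ff // Gg.
Qed.

Lemma smooth_mapZ V W (A : set V) (a : V -> R) (g : V -> W) :
  smooth_map A a -> smooth_map A g -> smooth_map A (fun x => a x *: g x).
Proof.
move=> sf sg x Ax; have [U [F [oU Ux sF Ff]]] := sf _ Ax.
have [U' [G [oU' U'x sG Gg]]] := sg _ Ax.
have o : open (U `&` U') by exact: openI.
exists (U `&` U'), (fun x => F x *: G x); split=> //.
  by move=> k; apply: CkZ => //; [apply: Ck_sub (sF k)|apply: Ck_sub (sG k)] => y [].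
by move=> y Ay [Uy U'y]; rewrite Ff // Gg.
Qed.

Lemma smooth_mapM V (A : set V) (a b : V -> R) :
  smooth_map A a -> smooth_map A b -> smooth_map A (fun x => a x * b x).
Proof. exact: smooth_mapZ. Qed.

Lemma smooth_mapN V W (A : set V) (f : V -> W) :
  smooth_map A f -> smooth_map A (fun x => - f x).
Proof.
move=> sf; have := smooth_mapZ (@smooth_map_cst _ _ A (- 1 : R)) sf.
by apply: smooth_map_eq => x _; rewrite scaleN1r.
Qed.

Lemma smooth_mapB V W (A : set V) (f g : V -> W) :
  smooth_map A f -> smooth_map A g -> smooth_map A (fun x => f x - g x).
Proof. by move=> sf /smooth_mapN; exact: smooth_mapD. Qed.

Lemma smooth_map_sum V W (A : set V) n (f : 'I_n -> V -> W) :
  (forall i, smooth_map A (f i)) -> smooth_map A (fun x => \sum_(i < n) f i x).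
Proof.
elim: n f => [|n IH] f sf.
  by under eq_fun do rewrite big_ord0; exact: smooth_map_cst.
by under eq_fun do rewrite big_ord_recr; apply: smooth_mapD => //; exact: IH.
Qed.

(** The local extension of the outer map can be used after shrinking to the
preimage of its domain under the extension of the inner map. *)
Lemma smooth_map_comp V W n (A : set V) (B : set 'rV[R]_n) (f : V -> 'rV[R]_n)
  (g : 'rV[R]_n -> W) : (forall x, A x -> B (f x)) ->
  smooth_map A f -> smooth_map B g -> smooth_map A (g \o f).
Proof.
move=> fAB sf sg x Ax; have [U [F [oU Ux sF Ff]]] := sf _ Ax.
have [U' [G [oU' U'x sG Gg]]] := sg _ (fAB _ Ax).
have o : open (U `&` F @^-1` U').
  rewrite openE => y [Uy FU'y]; apply: filterI; first exact: (near_open oU Uy).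
  have cF : F z @[z --> y] --> F y by exact: (sF 0%N y Uy).
  by apply: (cF U'); apply: open_nbhs_nbhs; split.
exists (U `&` F @^-1` U'), (G \o F); split=> //.
- by split=> //=; rewrite Ff.
- move=> k; apply: (@Ck_comp _ _ _ _ _ _ U') => //; first by move=> y [].
  by apply: Ck_sub (sF k) => y [].
- move=> y Ay [Uy U'y]; have Fy := Ff _ Ay Uy.
  by rewrite /= Fy Gg //; [exact: fAB | rewrite -Fy].
Qed.

Lemma smooth_map_coordP V n (A : set V) (f : V -> 'rV[R]_n) :
  smooth_map A f <-> forall i, smooth_map A (fun x => f x 0 i).
Proof.
split=> [sf i|sf].
  apply: (@smooth_map_comp _ _ _ _ setT f (@coordl _ _ i)) => //.
  by apply: smooth_map_lin; exact: coordl_continuous.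
apply: (@smooth_map_eq _ _ _ (fun x => \sum_(i < n) f x 0 i *: delta_mx 0 i)).
  by move=> x _; rewrite -row_sum_delta.
apply: (@smooth_map_sum _ _ _ _ (fun i x => f x 0 i *: delta_mx 0 i)) => i.
by apply: smooth_mapZ => //; exact: smooth_map_cst.
Qed.

Lemma smooth_map_dot V n (A : set V) (f g : V -> 'rV[R]_n) :
  smooth_map A f -> smooth_map A g -> smooth_map A (fun x => dot (f x) (g x)).
Proof.
move=> /smooth_map_coordP sf /smooth_map_coordP sg.
under eq_fun do rewrite dotE.
apply: (@smooth_map_sum _ _ _ _ (fun i x => f x 0 i * g x 0 i)) => i.
exact: smooth_mapM.
Qed.

Lemma smooth_map_vec3 V (A : set V) (a b c : V -> R) :
  smooth_map A a -> smooth_map A b -> smooth_map A c ->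
  smooth_map A (fun x => vec3 (a x) (b x) (c x)).
Proof.
move=> sa sb sc; apply/smooth_map_coordP => i.
under eq_fun do rewrite mxE.
by case: i => -[|[|[|//]]] /= _.
Qed.

Lemma smooth_map_cross V (A : set V) (f g : V -> 'rV[R]_3) :
  smooth_map A f -> smooth_map A g -> smooth_map A (fun x => cross (f x) (g x)).
Proof.
move=> /smooth_map_coordP sf /smooth_map_coordP sg.
by apply: smooth_map_vec3; apply: smooth_mapB; apply: smooth_mapM.
Qed.

Lemma smooth_differentiable V W (U : set V) (f : V -> W) x :
  smooth U f -> U x -> differentiable f x.
Proof. by move=> sf Ux; have [df _] := sf 1%N; exact: df. Qed.

Lemma smooth_derive V W (U : set V) (f : V -> W) v :
  smooth U f -> smooth U (fun x => 'D_v f x).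
Proof. by move=> sf k; have [_ Cf] := sf k.+1; exact: Cf. Qed.

Lemma smooth_continuous V W (U : set V) (f : V -> W) x :
  smooth U f -> U x -> {for x, continuous f}.
Proof. by move=> sf; exact: (sf 0%N). Qed.

End SmoothMaps.

(** * Derivatives along lines and curves *)

Section Curves.
Variable R : realType.
Implicit Types V W : normedModType R.

Lemma is_derive_diff_comp V W (f : V -> W) (c : R -> V) (s : R) dc :
  is_derive s 1 c dc -> differentiable f (c s) ->
  is_derive s (1 : R) (f \o c) ('D_dc f (c s)).
Proof.
move=> dcs df.
have dcd : differentiable c s by apply/derivable1_diffP; exact: ex_derive.
have dfc : differentiable (f \o c) s by exact: differentiable_comp.
apply: DeriveDef; first exact: diff_derivable.
by rewrite !deriveE // diff_comp //= -[in RHS](@derive_val _ _ _ _ _ _ _ dcs) deriveE.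
Qed.

Lemma is_derive_line V (p v : V) (s : R) :
  is_derive s (1 : R) (fun s => p + s *: v) v.
Proof.
have D : is_diff s (cst p + ( *:%R ^~ v)) (0 + ( *:%R ^~ v)) by apply: is_diffD.
have E : (fun s : R => p + s *: v) = cst p + ( *:%R ^~ v) by [].
rewrite E; apply: DeriveDef; first by apply: diff_derivable; exact: ex_diff.
rewrite deriveE; last exact: ex_diff.
by rewrite diff_val add0r scale1r.
Qed.

Lemma is_derive_along V W (f : V -> W) p v (s : R) :
  differentiable f (p + s *: v) ->
  is_derive s (1 : R) (fun s => f (p + s *: v)) ('D_v f (p + s *: v)).
Proof. by move=> df; exact: (is_derive_diff_comp (is_derive_line p v s)). Qed.

Lemma is_derive_along0 V W (f : V -> W) y v : differentiable f y ->
  is_derive (0 : R) (1 : R) (fun s => f (y + s *: v)) ('D_v f y).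
Proof.
move=> df; have E : y + (0 : R) *: v = y by rewrite scale0r addr0.
have := @is_derive_along V W f y v 0; rewrite E; exact.
Qed.

Lemma mean_value V (f : V -> R) p v (h : R) : 0 < h ->
  (forall s, 0 <= s <= h -> differentiable f (p + s *: v)) ->
  exists2 s, 0 <= s <= h & f (p + h *: v) - f p = h * 'D_v f (p + s *: v).
Proof.
move=> h0 df.
have D s : s \in `[0, h] -> is_derive s (1 : R) (fun s => f (p + s *: v)) ('D_v f (p + s *: v)).
  by rewrite in_itv /= => sh; apply: is_derive_along; exact: df.
have D1 s : s \in `]0, h[ -> is_derive s (1 : R) (fun s => f (p + s *: v)) ('D_v f (p + s *: v)).
  by move=> sh; apply: D; exact: subset_itv_oo_cc.
have C : {within `[0, h], continuous (fun s => f (p + s *: v))}.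
  by apply: derivable_within_continuous => r rh; have [] := D _ rh.
have [s sh E] := MVT h0 D1 C.
exists s; first by move: sh; rewrite in_itv /= => /andP[/ltW-> /ltW->].
by rewrite scale0r addr0 in E; rewrite E subr0 mulrC.
Qed.

End Curves.

(** * Symmetry of second derivatives *)

Section Schwarz.
Variable R : realType.
Implicit Types V : normedModType R.

Lemma differentiable_translate V (W : normedModType R) (f : V -> W) c y :
  differentiable f (y + c) -> differentiable (fun z => f (z + c)) y.
Proof.
move=> df; apply: (@differentiable_comp _ _ _ _ (fun z => z + c) f) => //.
Qed.

Lemma derive_translate V (W : normedModType R) (f : V -> W) v c y :
  'D_v (fun z => f (z + c)) y = 'D_v f (y + c).
Proof.
rewrite /derive; set g := (X in lim (X @ _)); set g' := (X in _ = lim (X @ _)).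
by have -> : g = g' by rewrite funeqE => h; rewrite /g /g' /= addrA.
Qed.

(** The second difference of F over a parallelogram, expressed by two
applications of the mean value theorem; it is symmetric in v and w. *)
Lemma mixed_difference V (F : V -> R) (U : set V) p v w h : 0 < h -> Ck 2 U F ->
  (forall s t, 0 <= s <= h -> 0 <= t <= h -> U (p + s *: v + t *: w)) ->
  exists s t, [/\ 0 <= s <= h, 0 <= t <= h &
    F (p + h *: v + h *: w) - F (p + h *: v) - F (p + h *: w) + F p =
    h * (h * 'D_w ('D_v F) (p + s *: v + t *: w))].
Proof.
move=> h0 [dF CF] Uh; have [dvF _] := CF v.
have hh : 0 <= h <= h by rewrite (ltW h0) /=.
have h00 : 0 <= (0:R) <= h by rewrite (ltW h0) andbT.
have U0 s : 0 <= s <= h -> U (p + s *: v).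
  by move=> sh; have := Uh s 0 sh h00; rewrite scale0r addr0.
have dt s : 0 <= s <= h -> differentiable (fun z => F (z + h *: w)) (p + s *: v).
  by move=> sh; apply: differentiable_translate; apply: dF; exact: Uh.
have [|s sh E] := @mean_value _ _ (fun z => F (z + h *: w) - F z) p v h h0.
  by move=> s sh; apply: differentiableB; [exact: dt | apply: dF; exact: U0].
have [|t th E'] := @mean_value _ _ ('D_v F) (p + s *: v) w h h0.
  by move=> t th; apply: dvF; exact: Uh.
exists s, t; split=> //.
rewrite -E' -derive_translate.
have -> : 'D_v (fun z => F (z + h *: w)) (p + s *: v) - 'D_v F (p + s *: v) =
    'D_v (fun z => F (z + h *: w) - F z) (p + s *: v).
  rewrite [RHS](@deriveB _ _ _ (fun z => F (z + h *: w)) F) //.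
    by apply: diff_derivable; exact: dt.
  by apply: diff_derivable; apply: dF; exact: U0.
by rewrite -E opprB addrAC addrA; ring.
Qed.

(** Equality is only tested at nearby points p and q, which may differ: the mean
value theorem yields different intermediate points for the two orders of
differentiation. *)
Lemma eq_of_meeting_values V (A B : V -> R) x :
  {for x, continuous A} -> {for x, continuous B} ->
  (forall d, 0 < d -> exists p q, [/\ `|p - x| < d, `|q - x| < d & A p = B q]) ->
  A x = B x.
Proof.
move=> cA cB meet; apply/eqP; rewrite -subr_eq0 -normr_le0; apply/ler_addgt0Pl => e e0.
rewrite addr0; have e2 : 0 < e / 2 by rewrite divr_gt0.
have nA : \forall y \near x, `|A x - A y| < e / 2.
  by have /cvgrPdist_lt/(_ _ e2) : A y @[y --> x] --> A x by exact: cA.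
have nB : \forall y \near x, `|B x - B y| < e / 2.
  by have /cvgrPdist_lt/(_ _ e2) : B y @[y --> x] --> B x by exact: cB.
have : \forall y \near x, `|A x - A y| < e / 2 /\ `|B x - B y| < e / 2.
  by apply: filterS2 nA nB => y ? ?; split.
move=> /nbhs_normP[d /= d0 Hd]; have [p [q [pd qd Apq]]] := meet _ d0.
have [Ap _] : `|A x - A p| < e / 2 /\ `|B x - B p| < e / 2.
  by apply: Hd; rewrite /ball_ /= distrC.
have [_ Bq] : `|A x - A q| < e / 2 /\ `|B x - B q| < e / 2.
  by apply: Hd; rewrite /ball_ /= distrC.
have -> : A x - B x = (A x - A p) - (B x - B q) by rewrite Apq opprB addrA subrK.
apply: (le_trans (ler_normB _ _)); rewrite [e]splitr.
by apply: lerD; exact: ltW.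
Qed.

Lemma small_box V (x v w : V) (d : R) : 0 < d -> exists2 h : R, 0 < h &
  forall s t, 0 <= s <= h -> 0 <= t <= h -> `|x + s *: v + t *: w - x| < d.
Proof.
move=> d0; pose c := `|v| + `|w| + 1; have c0 : 0 < c by rewrite ltr_wpDl // addr_ge0.
exists (d / c / 2); first by rewrite !divr_gt0.
move=> s t /andP[s0 sh] /andP[t0 th].
rewrite addrAC [x + _]addrC addrK.
apply: (le_lt_trans (ler_normD _ _)); rewrite !normrZ !ger0_norm //.
apply: (@le_lt_trans _ _ (d / c / 2 * `|v| + d / c / 2 * `|w|)).
  by rewrite lerD // ler_wpM2r.
rewrite -mulrDr; apply: (@le_lt_trans _ _ (d / c / 2 * c)).
  by rewrite ler_wpM2l ?divr_ge0 ?ltW // /c ltrDl.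
by rewrite mulrAC divfK ?gt_eqF // ltr_pdivrMr // mulr_natr mulr2n ltrDl.
Qed.

(** The two mixed derivatives take a common value near x, namely the second
difference divided by h^2, and both are continuous. *)
Lemma schwarz_real V (F : V -> R) (U : set V) x v w : open U -> U x -> Ck 2 U F ->
  'D_w ('D_v F) x = 'D_v ('D_w F) x.
Proof.
move=> oU Ux CF; have [_ CF1] := CF; have [_ Cv] := CF1 v; have [_ Cw] := CF1 w.
apply: (@eq_of_meeting_values _ ('D_w ('D_v F)) ('D_v ('D_w F))).
- exact: Cv.
- exact: Cw.
move=> d d0.
have [r /= r0 Hr] : exists2 r : R, 0 < r & forall y, `|y - x| < r -> U y.
  have /nbhs_normP[r /= r0 Hr] : nbhs x U by exact: open_nbhs_nbhs.
  by exists r => // y yr; apply: Hr; rewrite /ball_ /= distrC.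
have m0 : 0 < Num.min d r by rewrite lt_min d0.
have [h h0 Hh] := small_box x v w m0.
have box s t : 0 <= s <= h -> 0 <= t <= h ->
    `|x + s *: v + t *: w - x| < d /\ U (x + s *: v + t *: w).
  move=> sh th; have := Hh s t sh th; rewrite lt_min => /andP[? ?].
  by split=> //; exact: Hr.
have box' s t : 0 <= s <= h -> 0 <= t <= h ->
    `|x + s *: w + t *: v - x| < d /\ U (x + s *: w + t *: v).
  by move=> sh th; rewrite [x + s *: w + _]addrAC; exact: box.
have [s [t [sh th E]]] := mixed_difference h0 CF (fun s t sh th => (box s t sh th).2).
have [s' [t' [sh' th' E']]] := mixed_difference h0 CF (fun s t sh th => (box' s t sh th).2).
exists (x + s *: v + t *: w), (x + s' *: w + t' *: v); split.
- exact: (box _ _ sh th).1.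
- exact: (box' _ _ sh' th').1.
have h00 : h != 0 by rewrite gt_eqF.
apply: (mulfI h00); apply: (mulfI h00); apply: etrans (esym E) (etrans _ E').
by rewrite [x + h *: w + _]addrAC; ring.
Qed.

Lemma schwarz V n (F : V -> 'rV[R]_n) (U : set V) x v w : open U -> U x ->
  Ck 2 U F -> 'D_w ('D_v F) x = 'D_v ('D_w F) x.
Proof.
move=> oU Ux CF; have [dF CF1] := CF.
have ddF b : differentiable ('D_b F) x by have [+ _] := CF1 b; apply.
apply/rowP => i; pose Fi y := F y 0 i.
have nE b : \forall y \near x, ('D_b F y) 0 i = 'D_b Fi y.
  have nU : \forall y \near x, U y by exact: open_nbhs_nbhs.
  by apply: filterS nU => y /dF dFy; exact: esym (derive_coord b i dFy).
have key a b : ('D_a ('D_b F) x) 0 i = 'D_a ('D_b Fi) x.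
  exact: etrans (esym (derive_coord a i (ddF b))) (near_eq_derive a (nE b)).
have CFi : Ck 2 U Fi by exact: (Ck_coordP 2 F oU).1 CF i.
exact: etrans (key w v) (etrans (schwarz_real v w oU Ux CFi) (esym (key v w))).
Qed.

End Schwarz.

(** * The Poincare lemma on star-shaped sets *)

Section C1Differentiable.
Variable R : realType.

(** Continuity of the gradient upgrades directional derivatives to
differentiability, by the mean value theorem on the segment from x to x + h. *)
Lemma differentiable_of_directional n (S : set 'rV[R]_n) (P : 'rV[R]_n -> R)
    (b : 'rV[R]_n -> 'rV[R]_n) x : open S -> S x ->
  (forall y v, S y -> is_derive y v P (dot (b y) v)) ->
  {for x, continuous b} -> differentiable P x.
Proof.
move=> oS Sx dP cb.
suff : is_diff x P (dotf (b x)) by case.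
apply/is_diffP_eps; first exact: dotf_continuous.
move=> e e0.
have : \forall y \near x, S y /\ \sum_(i < n) `|(b y - b x) 0 i| < e.
  have nS : \forall y \near x, S y by exact: open_nbhs_nbhs.
  have nb : \forall y \near x, \sum_(i < n) `|(b y - b x) 0 i| < e; last first.
    by apply: filterS2 nS nb => y ? ?; split.
  have e1 : 0 < e / n.+1%:R by rewrite divr_gt0 // ltr0n.
  move/cvgrPdist_lt : (cb : b y @[y --> x] --> b x) => /(_ _ e1).
  apply: filterS => y; rewrite distrC => H.
  apply: (@le_lt_trans _ _ (\sum_(i < n) (e / n.+1%:R))).
    by apply: ler_sum => i _; apply: (le_trans (coord_le_norm _ _)); exact: ltW.
  rewrite sumr_const card_ord -[ltLHS]mulr_natr -mulrA gtr_pMr //.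
  by rewrite mulrC ltr_pdivrMr ?mul1r ?ltr0n // ltr_nat.
move=> /nbhs_normP[d /= d0 Hd].
have n0 : \forall h \near (0 : 'rV[R]_n), `|h| < d.
  by apply/nbhs_normP; exists d => //= h; rewrite /ball_ /= sub0r normrN.
apply: filterS n0 => h hd.
have Hs (s : R) : 0 <= s <= 1 -> S (x + s *: h) /\ \sum_(i < n) `|(b (x + s *: h) - b x) 0 i| < e.
  move=> /andP[s0 s1]; apply: Hd; rewrite /ball_ /= opprD addrA subrr add0r normrN.
  rewrite normrZ ger0_norm //; apply: le_lt_trans hd.
  by rewrite ler_piMl.
have D (s : R) : s \in `[0, 1] -> is_derive s (1 : R) (fun s => P (x + s *: h)) (dot (b (x + s *: h)) h).
  rewrite in_itv /= => s01.
  have [+ _] := Hs _ s01 => Ss; have [dd <-] := dP _ h Ss.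
  have E : (fun k : R => k^-1 *: (((fun s => P (x + s *: h)) \o shift s) (k *: (1:R)) - P (x + s *: h))) =
    (fun k : R => k^-1 *: ((P \o shift (x + s *: h)) (k *: h) - P (x + s *: h))).
    rewrite funeqE => k /=; congr (_ *: (P _ - _)).
    by rewrite [k *: 1]mulr1 scalerDl addrCA.
  by apply: DeriveDef; rewrite /derivable /derive E.
have D1 (s : R) : s \in `]0, 1[ -> is_derive s (1 : R) (fun s => P (x + s *: h)) (dot (b (x + s *: h)) h).
  by move=> s01; apply: D; exact: subset_itv_oo_cc.
have C : {within `[0, 1 : R], continuous (fun s => P (x + s *: h))}.
  by apply: derivable_within_continuous => r rh; have [] := D _ rh.
have [s s01 E] := MVT ltr01 D1 C.
rewrite scale1r scale0r addr0 subr0 mulr1 in E; rewrite [h + x]addrC E.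
rewrite -[leLHS]/(`|dot (b (x + s *: h)) h - dot (b x) h|) -dotBl; apply: (le_trans (dot_le _ _)).
have [|_ /ltW H] := Hs s; last by rewrite ler_wpM2r.
by move: s01; rewrite in_itv /= => /andP[/ltW-> /ltW->].
Qed.

End C1Differentiable.

Section Star.
Variable R : realType.

Lemma is_derive_coordP n (c : R -> 'rV[R]_n) (s : R) dc :
  is_derive s (1 : R) c dc <-> forall i, is_derive s (1:R) (fun s => c s 0 i) (dc 0 i).
Proof.
split=> [[dcs <-] i|H].
  apply: DeriveDef; first by apply: (derivable_mxP _ _ _).1.
  by rewrite derive_mx // mxE.
have dcs : derivable c s 1.
  by apply/derivable_mxP => i j; rewrite (ord1 i); have [] := H j.
apply: DeriveDef => //; rewrite derive_mx //; apply/rowP => i; rewrite mxE.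
by have [] := H i.
Qed.

Lemma is_derive_sumE n (f : 'I_n -> R -> R) (df : 'I_n -> R) (s : R) :
  (forall i, is_derive s (1:R) (f i) (df i)) ->
  is_derive s (1:R) (fun s => \sum_(i < n) f i s) (\sum_(i < n) df i).
Proof.
move=> H; have := is_derive_sum H.
by rewrite (_ : \sum_(i < n) f i = fun s => \sum_(i < n) f i s) // funeqE => t; rewrite fct_sumE.
Qed.

Lemma is_derive_mul (f g : R -> R) (s df dg : R) :
  is_derive s (1 : R) f df -> is_derive s (1 : R) g dg ->
  is_derive s (1 : R) (fun s => f s * g s) (df * g s + f s * dg).
Proof.
move=> Hf Hg; apply: (@is_derive_eq _ _ _ _ _ _ _ _ (is_deriveM Hf Hg)).
by rewrite /GRing.scale /=; ring.
Qed.

Lemma is_derive_dot n (c d : R -> 'rV[R]_n) (s : R) dc dd :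
  is_derive s (1 : R) c dc -> is_derive s (1 : R) d dd ->
  is_derive s (1 : R) (fun s => dot (c s) (d s)) (dot dc (d s) + dot (c s) dd).
Proof.
move=> /is_derive_coordP Hc /is_derive_coordP Hd.
under eq_fun do rewrite dotE.
have := is_derive_sumE (fun i => is_derive_mul (Hc i) (Hd i)).
by rewrite big_split /= !dotE.
Qed.

(** The potential is P y = integral over [0, 1] of <b (a + t (y - a)), y - a>.
Differentiating under the integral sign along v, the symmetry of the
derivative of b turns the integrand into d/dt (t <b (a + t (y - a)), v>). *)
Lemma poincare_star n (S : set 'rV[R]_n) a (b : 'rV[R]_n -> 'rV[R]_n) :
  open S -> (forall y t, S y -> 0 <= t <= 1 -> S (a + t *: (y - a))) ->
  smooth S b ->
  (forall y v w, S y -> dot ('D_v b y) w = dot ('D_w b y) v) ->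
  exists P : 'rV[R]_n -> R, forall y, S y ->
    differentiable P y /\ forall v, 'D_v P y = dot (b y) v.
Proof.
move=> oS starS sb closedb.
pose P y := \int[lebesgue_measure]_(t in `[0, 1]) dot (b (a + t *: (y - a))) (y - a).
suff dP y v : S y -> is_derive y v P (dot (b y) v).
  exists P => y Sy; split; last by move=> v; have [] := dP y v Sy.
  apply: (@differentiable_of_directional _ _ S _ b) => //.
  exact: smooth_continuous sb Sy.
move=> Sy.
(* p = (s, t): the point at parameter t of the segment from a to y + s v.
   Then f is the integrand of P (y + s v) and g its derivative in s. *)
pose gam (p : R * R) := a + p.2 *: (y + p.1 *: v - a).
pose f (p : R * R) := dot (b (gam p)) (y + p.1 *: v - a).
pose g (p : R * R) := p.2 * dot ('D_v b (gam p)) (y + p.1 *: v - a) + dot (b (gam p)) v.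
have sfst A : smooth_map A (fst : R * R -> R).
  by apply: (@smooth_map_lin _ _ _ A fst) => p; exact: cvg_fst.
have ssnd A : smooth_map A (snd : R * R -> R).
  by apply: (@smooth_map_lin _ _ _ A snd) => p; exact: cvg_snd.
have sd A : smooth_map A (fun p : R * R => y + p.1 *: v - a).
  apply: smooth_mapB; last exact: smooth_map_cst.
  apply: smooth_mapD; first exact: smooth_map_cst.
  by apply: smooth_mapZ => //; exact: smooth_map_cst.
have sgam A : smooth_map A gam.
  apply: smooth_mapD; first exact: smooth_map_cst.
  by apply: smooth_mapZ.
have gamc : continuous gam.
  move=> p; apply: (@smooth_continuous _ _ _ setT) => //.
  by apply: smooth_map_open; [exact: openT | exact: sgam].
pose Om := gam @^-1` S.
have oOm : open Om by apply: open_comp => // p _; exact: gamc.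
have SS A : A `<=` S -> smooth_map A b by move=> AS; apply: smooth_smooth_map sb.
have sbg : smooth_map Om (b \o gam) by apply: (@smooth_map_comp _ _ _ _ _ S) => //; exact: SS.
have sDbg : smooth_map Om (('D_v b) \o gam).
  apply: (@smooth_map_comp _ _ _ _ _ S) => //.
  by apply: (@smooth_smooth_map _ _ _ _ S) => //; exact: smooth_derive.
have sf : smooth Om f by apply: smooth_map_open => //; apply: smooth_map_dot.
have sg : smooth Om g.
  apply: smooth_map_open => //; apply: smooth_mapD.
    by apply: smooth_mapM => //; apply: smooth_map_dot.
  by apply: smooth_map_dot => //; exact: smooth_map_cst.
have [e e0 He] : exists2 e : R, 0 < e & forall s, `|s| <= e -> S (y + s *: v).
  have c : (fun s : R => y + s *: v) s @[s --> (0 : R)] --> y + 0 *: v.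
    by apply: cvgD; [exact: cvg_cst | apply: cvgZ; [exact: cvg_id | exact: cvg_cst]].
  have : \forall s \near (0:R), S (y + s *: v).
    by apply: c; apply: open_nbhs_nbhs; split => //; rewrite scale0r addr0.
  move=> /nbhs_normP[d /= d0 Hd]; exists (d / 2); first by rewrite divr_gt0.
  move=> s sd2; apply: Hd; rewrite /ball_ /= sub0r normrN (le_lt_trans sd2) //.
  by rewrite ltr_pdivrMr // mulr_natr mulr2n ltrDl.
have KOm s t : `|s| <= e -> 0 <= t <= 1 -> Om (s, t).
  by move=> se t01; apply: starS => //; exact: He.
have dfs s t : `|s| <= e -> 0 <= t <= 1 ->
    is_derive s (1 : R) (fun s => f (s, t)) (g (s, t)).
  move=> se t01.
  have d1 : is_derive s (1 : R) (fun s => y + s *: v - a) v.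
    under eq_fun do rewrite addrAC.
    exact: is_derive_line.
  have d2 : is_derive s (1 : R) (fun s => gam (s, t)) (t *: v).
    have -> : (fun s => gam (s, t)) = fun s => (a + t *: (y - a)) + s *: (t *: v).
      rewrite funeqE => z; rewrite /gam /= [y + _ - a]addrAC scalerDr addrA.
      by rewrite !scalerA [z * t]mulrC.
    exact: is_derive_line.
  have db : differentiable b (gam (s, t)) by apply: smooth_differentiable sb _; exact: KOm.
  have d3 := is_derive_diff_comp d2 db.
  have := is_derive_dot d3 d1.
  rewrite /g /= deriveE // linearZ /= -deriveE // dotZl.
  exact.
(* A maximum of |g| on this compact set dominates the derivatives. *)
pose K := `[- e, e]%classic `*` `[0, 1 : R]%classic.
have Kc : compact K by apply: compact_setX; exact: segment_compact.
have KO p : K p -> Om p.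
  case: p => s t [] /=; rewrite !in_itv /= -ler_norml => se t01.
  exact: KOm.
have cg : {within K, continuous (fun p => `|g p|)}.
  apply: continuous_in_subspaceT => p /set_mem /KO Op.
  by apply: cvg_norm; exact: (smooth_continuous sg Op).
have K0 : K (0, 0) by split; rewrite /= in_itv /= ?lexx ?ler01 // oppr_le0 ltW.
have [p0 Kp0 maxg] := compact_EVT_max (ex_intro _ _ K0) Kc cg.
have inI (s : R) : `]-e, e[%classic s -> `|s| <= e.
  by rewrite /= in_itv /= -ltr_norml => /ltW.
have ctf (s : R) (h : R * R -> R) : smooth Om h -> `|s| <= e ->
    {within `[0, 1], continuous (fun t => h (s, t))}.
  move=> sh se; apply: continuous_in_subspaceT => t /set_mem /=; rewrite in_itv /= => t01.
  have cst : (s, t') @[t' --> t] --> (s, t) by apply: (cvg_pair (cvg_cst s) cvg_id).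
  by apply: (@continuous_comp _ _ _ (fun t => (s, t)) h t cst); exact: smooth_continuous sh (KOm _ _ se t01).
have intf (s : R) : `]-e, e[%classic s ->
    lebesgue_measure.-integrable `[0, 1] (EFin \o (fun t => f (s, t))).
  move=> /inI se; apply: continuous_compact_integrable; first exact: segment_compact.
  exact: ctf.
have I0 : `]-e, e[%classic (0 : R) by rewrite /= in_itv /= oppr_lt0 e0.
have part (s t : R) : `]-e, e[%classic s -> `[0, 1]%classic t ->
    partial1of2 (fun s t => f (s, t)) s t = g (s, t).
  rewrite [X in _ -> X -> _]/= in_itv => /inI se t01; rewrite partial1of2E.
  by have [] := dfs s t se t01.
have der (s t : R) : `]-e, e[%classic s -> `[0, 1]%classic t ->
    derivable ((fun s t => f (s, t))^~ t) s 1.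
  rewrite [X in _ -> X -> _]/= in_itv => /inI se t01.
  by have [] := dfs s t se t01.
have intG : (@lebesgue_measure R).-integrable `[0, 1] (EFin \o (fun=> `|g p0|)).
  apply: continuous_compact_integrable; first exact: segment_compact.
  by apply: continuous_subspaceT => x; exact: cvg_cst.
have Gub (s t : R) : `]-e, e[%classic s -> `[0, 1]%classic t ->
    `|partial1of2 (fun s t => f (s, t)) s t| <= `|g p0|.
  move=> sI tI; rewrite part //; apply: maxg; rewrite inE; split => //.
  by move: sI => /inI; rewrite ler_norml /= in_itv.
have mI : measurable `[0, 1 : R]%classic by exact: measurable_itv.
have lim := @cvg_differentiation_under_integral R _ _ lebesgue_measure
  (fun s t => f (s, t)) `[0, 1]%classic mI 0 (- e) e I0 intf der (fun=> `|g p0|)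
  (fun=> normr_ge0 _) intG Gub.
have ftc : \int[lebesgue_measure]_(t in `[0, 1])
    partial1of2 (fun s t => f (s, t)) 0 t = dot (b y) v.
  transitivity (\int[lebesgue_measure]_(t in `[0, 1]) g (0, t)).
    by apply: eq_Rintegral => t /set_mem t01; exact: part.
  have norm0 : `|0 : R| <= e by rewrite normr0 ltW.
  (* By closedness of b, the primitive of t |-> g (0, t). *)
  pose H (t : R) := t * dot (b (gam (0, t))) v.
  have dH (t : R) : 0 <= t <= 1 -> is_derive t (1 : R) H (g (0, t)).
    move=> t01.
    have d2 : is_derive t (1 : R) (fun t => gam (0, t)) (y - a).
      under eq_fun do rewrite /gam /= scale0r addr0.
      exact: is_derive_line.
    have db : differentiable b (gam (0, t)) by apply: smooth_differentiable sb _; exact: KOm.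
    have d3 := is_derive_diff_comp d2 db.
    have d4 := is_derive_dot d3 (is_derive_cst v t 1).
    have d5 := is_derive_mul (is_derive_id t (1 : R)) d4.
    apply: is_derive_eq d5 _.
    rewrite /g /= dot0r addr0 scale0r addr0 mul1r addrC closedb //.
    exact: KOm.
  rewrite /Rintegral (@continuous_FTC2 _ _ H 0 1) //.
  - rewrite -EFinB /= /H mul1r mul0r subr0 /gam /= scale1r scale0r addr0.
    by rewrite addrC subrK.
  - exact: ctf.
  - have cH (t : R) : 0 <= t <= 1 -> H t' @[t' --> t] --> H t.
      move=> t01; have [/derivable1_diffP + _] := dH t t01.
      exact: differentiable_continuous.
    split.
    + by move=> t; rewrite in_itv /= => /andP[/ltW t0 /ltW t1]; have [|] := dH t; rewrite ?t0 ?t1.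
    + by apply: cvg_at_right_filter; apply: cH; rewrite lexx ler01.
    + by apply: cvg_at_left_filter; apply: cH; rewrite lexx ler01.
  - move=> t; rewrite in_itv /= => /andP[/ltW t0 /ltW t1].
    by rewrite derive1E; have [|] := dH t; rewrite ?t0 ?t1.
have {}lim : h^-1 *: ((P \o shift y) (h *: v) - P y) @[h --> 0^'] --> dot (b y) v.
  rewrite -ftc; move: lim.
  set A := (X in X @ _ --> _ -> _); set B := (X in _ -> X @ _ --> _).
  suff -> : A = B by [].
  rewrite funeqE => h; rewrite /A /B /=; congr (_ *: (_ - _)).
    by rewrite addr0 /f /P /gam /= [y + _]addrC.
  by rewrite /f /P /gam /= scale0r addr0.
apply: DeriveDef; last exact/cvg_lim.
by apply/cvg_ex; exists (dot (b y) v).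
Qed.

End Star.

(** * The Poincare lemma on space minus a point *)

Section Punctured.
Variable R : realType.
Implicit Types x y z v w : 'rV[R]_3.

Lemma vec3_0 (a b c : R) : vec3 a b c 0 0 = a. Proof. by rewrite mxE. Qed.
Lemma vec3_1 (a b c : R) : vec3 a b c 0 1 = b. Proof. by rewrite mxE. Qed.
Lemma vec3_2 (a b c : R) : vec3 a b c 0 2 = c. Proof. by rewrite mxE. Qed.
Definition vec3E := (vec3_0, vec3_1, vec3_2).

Lemma row3P x y : x 0 0 = y 0 0 -> x 0 1 = y 0 1 -> x 0 2 = y 0 2 -> x = y.
Proof.
move=> e0 e1 e2; apply/rowP => -[[|[|[|//]]] lti].
- by rewrite (_ : Ordinal lti = 0) //; exact: val_inj.
- by rewrite (_ : Ordinal lti = 1) //; exact: val_inj.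
- by rewrite (_ : Ordinal lti = 2) //; exact: val_inj.
Qed.

Lemma dot3E v w : dot v w = v 0 0 * w 0 0 + v 0 1 * w 0 1 + v 0 2 * w 0 2.
Proof.
rewrite dotE !big_ord_recl big_ord0 addr0 addrA.
congr (_ + _ + _); congr (v 0 _ * w 0 _); exact: val_inj.
Qed.

(** For s = 1 or s = -1, the complement of the closed half of the third axis on
which s y_2 <= 0; it is star-shaped about s e3. *)
Definition slit (s : R) : set 'rV[R]_3 :=
  [set y | y 0 0 != 0 \/ y 0 1 != 0 \/ 0 < s * y 0 2].

Definition offaxis : set 'rV[R]_3 := [set y | y 0 0 != 0 \/ y 0 1 != 0].

Lemma open_coord_neq0 (i : 'I_3) : open [set y : 'rV[R]_3 | y 0 i != 0].
Proof.
have -> : [set y : 'rV[R]_3 | y 0 i != 0] = (coordl R i) @^-1` [set x : R | x != 0].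
  by [].
by apply: open_comp; [move=> x _; exact: coordl_continuous | exact: open_neq].
Qed.

Lemma open_offaxis : open offaxis.
Proof.
have -> : offaxis = [set y | y 0 0 != 0] `|` [set y | y 0 1 != 0] by [].
by apply: openU; exact: open_coord_neq0.
Qed.

Lemma open_slit s : open (slit s).
Proof.
have -> : slit s = offaxis `|` (coordl R 2) @^-1` [set z : R | 0 < s * z].
  rewrite eqEsubset; split=> y; rewrite /slit /offaxis /=; tauto.
apply: openU; first exact: open_offaxis.
apply: open_comp; first by move=> x _; exact: coordl_continuous.
have -> : [set z : R | 0 < s * z] = ( *%R s) @^-1` [set z : R | 0 < z] by [].
apply: open_comp; last exact: open_gt.
by move=> x _; exact: mulrl_continuous.
Qed.

Lemma slit_star s y t : s * s = 1 -> slit s y -> 0 <= t <= 1 ->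
  slit s (vec3 0 0 s + t *: (y - vec3 0 0 s)).
Proof.
move=> ss Sy /andP[t0 t1]; rewrite /slit /= !mxE /= !subr0 !add0r.
have -> : s * (s + t * (y 0 2 - s)) = (1 - t) + t * (s * y 0 2).
  transitivity (s * s - t * (s * s) + t * (s * y 0 2)); first by ring.
  by rewrite ss mulr1.
move: t0; rewrite le_eqVlt => /predU1P[<-|t0].
  by right; right; rewrite mul0r subr0 addr0 ltr01.
have tn : t != 0 by rewrite gt_eqF.
case: Sy => [y0|[y1|y2]]; first by left; rewrite mulf_neq0.
  by right; left; rewrite mulf_neq0.
right; right; rewrite -[ltLHS]addr0 ler_ltD ?subr_ge0 //.
by rewrite mulr_gt0.
Qed.

Lemma offaxis_slit s y : offaxis y -> slit s y.
Proof. by case=> h; [left | right; left]. Qed.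

Lemma slit_neq0 s y : slit s y -> y != 0.
Proof.
by move=> Sy; apply/eqP => y0; move: Sy; rewrite y0 /slit /= !mxE mulr0 eqxx ltxx; case=> // -[].
Qed.

Lemma neq0_slit y : y != 0 -> slit 1 y \/ slit (-1) y.
Proof.
move=> yn0; rewrite /slit /= mul1r mulN1r oppr_gt0.
have [y0|] := eqVneq (y 0 0) 0; last by left; left.
have [y1|] := eqVneq (y 0 1) 0; last by left; right; left.
case: (ltgtP 0 (y 0 2)) => y2; [by left; right; right | by right; right; right |].
by case/eqP: yn0; apply: row3P; rewrite !mxE.
Qed.

(** Two points whose horizontal parts are not parallel are joined by a segment
that misses the axis.  Parallel ones are joined through a third point,
obtained by rotating one of them by a right angle. *)
Lemma constant_offaxis (D : 'rV[R]_3 -> R) :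
  (forall y, offaxis y -> differentiable D y /\ forall v, 'D_v D y = 0) ->
  forall y z, offaxis y -> offaxis z -> D y = D z.
Proof.
move=> dD.
have seg y z : y 0 0 * z 0 1 - y 0 1 * z 0 0 != 0 -> D y = D z.
  move=> yz.
  have off (s : R) : 0 <= s <= 1 -> offaxis (y + s *: (z - y)).
    move=> /andP[s0 s1]; rewrite /offaxis /= !mxE.
    apply/orP; rewrite -negb_and; apply: contra yz => /andP[/eqP e0 /eqP e1].
    have [sE|sN] := eqVneq s 0.
      by move: e0 e1; rewrite sE !mul0r !addr0 => -> ->; rewrite !mul0r subr0.
    apply/eqP/(mulfI sN); rewrite mulr0.
    transitivity (y 0 0 * (y 0 1 + s * (z 0 1 - y 0 1)) -
                  y 0 1 * (y 0 0 + s * (z 0 0 - y 0 0))); first by ring.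
    by rewrite e0 e1 !mulr0 subrr.
  have [|s s01] := @mean_value _ _ D y (z - y) 1 ltr01.
    by move=> s s01; have [] := dD _ (off _ s01).
  have [_ ->] := dD _ (off _ s01).
  by rewrite scale1r mulr0 [y + _]addrC subrK => /eqP; rewrite subr_eq0 => /eqP ->.
move=> y z oy oz.
have [yz|] := eqVneq (y 0 0 * z 0 1 - y 0 1 * z 0 0) 0; last exact: seg.
have nn (x : 'rV[R]_3) : offaxis x -> 0 < x 0 0 * x 0 0 + x 0 1 * x 0 1.
  rewrite -!expr2; case=> h.
    by rewrite ltr_pwDl ?sqr_ge0 // exprn_even_gt0.
  by rewrite ltr_wpDl ?sqr_ge0 // exprn_even_gt0.
have ny := nn _ oy; have nz := nn _ oz.
pose w : 'rV[R]_3 := vec3 (- y 0 1) (y 0 0) 0.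
rewrite (seg y w); last by rewrite !vec3E mulrN opprK gt_eqF.
apply: seg; rewrite !vec3E.
apply/eqP => E.
have : (y 0 0 * y 0 0 + y 0 1 * y 0 1) * (z 0 0 * z 0 0 + z 0 1 * z 0 1) = 0.
  (* Lagrange's identity *)
  rewrite (_ : _ * _ = (y 0 0 * z 0 1 - y 0 1 * z 0 0) ^+ 2 + (- y 0 1 * z 0 1 - y 0 0 * z 0 0) ^+ 2); last by ring.
  by rewrite yz E expr0n /= addr0.
by move/eqP; rewrite mulf_eq0 !gt_eqF.
Qed.

(** The two slit spaces [slit 1] and [slit (-1)] cover the punctured space and
meet in the complement of the axis, where the difference of the two potentials
is constant. *)
Lemma poincare_punctured (b : 'rV[R]_3 -> 'rV[R]_3) :
  smooth [set y | y != 0] b ->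
  (forall y v w, y != 0 -> dot ('D_v b y) w = dot ('D_w b y) v) ->
  exists P : 'rV[R]_3 -> R, forall y, y != 0 ->
    differentiable P y /\ forall v, 'D_v P y = dot (b y) v.
Proof.
move=> sb cb.
have star (s : R) : s * s = 1 -> exists P : 'rV[R]_3 -> R, forall y, slit s y ->
    differentiable P y /\ forall v, 'D_v P y = dot (b y) v.
  move=> ss; apply: (@poincare_star _ _ (slit s) (vec3 0 0 s)).
  - exact: open_slit.
  - by move=> y t; exact: slit_star.
  - by move=> k; apply: Ck_sub (sb k) => y; exact: slit_neq0.
  - by move=> y v w /slit_neq0; exact: cb.
have [P HP] := star 1 (mulr1 1).
have [Q HQ] := star (-1) (etrans (mulrNN 1 1) (mulr1 1)).
have PQ y : offaxis y -> differentiable (P - Q) y /\ forall v, 'D_v (P - Q) y = 0.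
  move=> oy; have [dP DP] := HP _ (offaxis_slit 1 oy).
  have [dQ DQ] := HQ _ (offaxis_slit (-1) oy).
  split; first exact: differentiableB.
  by move=> v; rewrite deriveB ?DP ?DQ ?subrr //; exact: diff_derivable.
have cPQ := constant_offaxis PQ.
pose c := (P - Q) (vec3 1 0 0).
have o1 : offaxis (vec3 1 0 0) by left; rewrite vec3E oner_eq0.
(* c is the value of P - Q at e1, hence everywhere off the axis. *)
pose T y := if pselect (slit 1 y) then P y else Q y + c.
have TP y : slit 1 y -> T y = P y by rewrite /T; case: pselect.
have TQ y : slit (-1) y -> T y = Q y + c.
  rewrite /T; case: pselect => // S1 S2.
  have oy : offaxis y.
    case: S1 => [|[|y2]]; [by left | by right |].
    case: S2 => [|[|]]; [by left | by right |].
    by rewrite mulN1r oppr_gt0 ltNge => /negP[]; rewrite ltW // -[ltRHS]mul1r.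
  have -> : c = P y - Q y by exact: (cPQ _ _ o1 oy).
  by rewrite addrC subrK.
exists T => y /neq0_slit[Sy|Sy].
  have [dP DP] := HP _ Sy.
  have nT : \forall z \near y, P z = T z.
    apply: (@filterS _ _ _ (slit 1)); last by apply: open_nbhs_nbhs; split => //; exact: open_slit.
    by move=> z /TP ->.
  split; first by have [] := is_diff_near nT dP.
  by move=> v; rewrite -(near_eq_derive v nT) DP.
have [dQ DQ] := HQ _ Sy.
have nT : \forall z \near y, (Q + cst c) z = T z.
  apply: (@filterS _ _ _ (slit (-1))); last by apply: open_nbhs_nbhs; split => //; exact: open_slit.
  by move=> z /TQ ->.
have dQc : differentiable (Q + cst c) y by apply: differentiableD.
split; first by have [] := is_diff_near nT dQc.
move=> v; rewrite -(near_eq_derive v nT) deriveD ?derive_cst ?addr0 //.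
exact: diff_derivable.
Qed.

End Punctured.

(** * Vector algebra in a tangent plane *)

Section VectorAlgebra.
Variable R : realType.
Implicit Types n v w K a b c : 'rV[R]_3.

Lemma crossE v w : (cross v w 0 0 = v 0 1 * w 0 2 - v 0 2 * w 0 1) *
  (cross v w 0 1 = v 0 2 * w 0 0 - v 0 0 * w 0 2) *
  (cross v w 0 2 = v 0 0 * w 0 1 - v 0 1 * w 0 0).
Proof. by rewrite /cross !vec3E. Qed.

Lemma crossC v w : cross v w = - cross w v.
Proof. by apply: row3P; rewrite !mxE /=; ring. Qed.

Lemma crossZr k v w : cross v (k *: w) = k *: cross v w.
Proof. by apply: row3P; rewrite !mxE /=; ring. Qed.

Lemma crossZl k v w : cross (k *: v) w = k *: cross v w.
Proof. by apply: row3P; rewrite !mxE /=; ring. Qed.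

Lemma cross0r v : cross v 0 = 0.
Proof. by rewrite -(scale0r 0) crossZr !scale0r. Qed.

Lemma dot_cross_cyc a b c : dot a (cross b c) = dot b (cross c a).
Proof. by rewrite !dot3E !crossE; ring. Qed.

Lemma dot_crossl a b : dot a (cross a b) = 0.
Proof. by rewrite !dot3E !crossE; ring. Qed.

Lemma dot_crossr a b : dot b (cross a b) = 0.
Proof. by rewrite !dot3E !crossE; ring. Qed.

Lemma triple_product a b c : cross a (cross b c) = dot a c *: b - dot a b *: c.
Proof. by apply: row3P; rewrite !dot3E !crossE !mxE; ring. Qed.

Lemma cross_jacobi a b c :
  cross a (cross b c) = cross (cross a b) c + cross b (cross a c).
Proof. by apply: row3P; rewrite [RHS]mxE !crossE; ring. Qed.

Lemma dot_cross_cross a b c d :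
  dot (cross a b) (cross c d) = dot a c * dot b d - dot a d * dot b c.
Proof. by rewrite !dot3E !crossE; ring. Qed.

(** The cross product of two tangent vectors is normal, since its cross product
with n expands to zero. *)
Lemma cross_normal n v w : dot n n = 1 -> dot n v = 0 -> dot n w = 0 ->
  cross v w = dot n (cross v w) *: n.
Proof.
move=> n1 nv nw; have := triple_product n n (cross v w).
rewrite (triple_product n v w) nv nw !scale0r subrr cross0r n1 scale1r => /eqP.
by rewrite eq_sym subr_eq0 => /eqP ->.
Qed.

Lemma triple_tangent n a b c : dot n n = 1 -> dot n a = 0 -> dot n b = 0 ->
  dot n c = 0 -> dot a (cross b c) = 0.
Proof.
by move=> n1 na nb nc; rewrite (cross_normal n1 nb nc) dotZr [dot a n]dotC na mulr0.
Qed.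

(** K and n x K form an orthogonal basis of the plane orthogonal to n, both of
length |K|; the factor |K|^2 avoids dividing by zero when K = 0. *)
Lemma tangent_frame n v K : dot n n = 1 -> dot n v = 0 -> dot n K = 0 ->
  dot K K *: v = dot v K *: K + dot v (cross n K) *: cross n K.
Proof.
move=> n1 nv nK; have := triple_product K v K.
rewrite (cross_normal n1 nv nK) crossZr dot_cross_cyc (crossC K n) dotNr.
by rewrite scalerN scaleNr opprK => ->; rewrite [dot v K]dotC addrC subrK.
Qed.

(** On a two-dimensional space, the linear functionals that vanish on a nonzero
vector K are proportional to each other. *)
Lemma functionals_killing_vector_parallel n K (al be : 'rV[R]_3 -> R) v w :
  dot n n = 1 -> dot n K = 0 -> dot K K != 0 ->
  dot n v = 0 -> dot n w = 0 ->
  (forall k a b, dot n a = 0 -> dot n b = 0 -> al (k *: a + b) = k * al a + al b) ->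
  (forall k a b, dot n a = 0 -> dot n b = 0 -> be (k *: a + b) = k * be a + be b) ->
  al K = 0 -> be K = 0 ->
  al v * be w = al w * be v.
Proof.
move=> n1 nK K0 nv nw lal lbe alK beK.
pose L := cross n K.
have nL : dot n L = 0 by exact: dot_crossl.
have n0 : dot n 0 = 0 by rewrite dot0r.
have key (f : 'rV[R]_3 -> R) u : 
    (forall k a b, dot n a = 0 -> dot n b = 0 -> f (k *: a + b) = k * f a + f b) ->
    f K = 0 -> dot n u = 0 -> dot K K * f u = dot u L * f L.
  move=> lf fK nu.
  have f0 : f 0 = 0.
    by have := lf 1 0 0 n0 n0; rewrite scaler0 addr0 mul1r => /eqP; rewrite -subr_eq0 opprD addrA subrr sub0r oppr_eq0 => /eqP.
  have fZ k a : dot n a = 0 -> f (k *: a) = k * f a.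
    by move=> na; rewrite -[k *: a]addr0 lf // f0 addr0.
  by rewrite -fZ // (tangent_frame n1 nu nK) lf ?dotZr ?nL ?mulr0 // fK mulr0 add0r fZ.
apply: (mulfI K0); apply: (mulfI K0).
transitivity (dot K K * al v * (dot K K * be w)); first by ring.
rewrite !key //.
transitivity (dot K K * al w * (dot K K * be v)); last by ring.
by rewrite !key //; ring.
Qed.

End VectorAlgebra.

(** * Derivatives along a surface *)

Section TangentialDerivative.
Variables (R : realType) (M : set 'rV[R]_3).
Implicit Types (x v w : 'rV[R]_3) (W : normedModType R).

Lemma is_derive1E W (c : R -> W) (s : R) d :
  derivable c s 1 -> derive1 c s = d -> is_derive s (1 : R) c d.
Proof. by move=> dc dE; apply: DeriveDef => //; rewrite -derive1E. Qed.

Lemma curve_is_derive x v c : curve_at M x v c -> is_derive (0 : R) (1 : R) c v.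
Proof.
case=> -[I [oI I0 sc _]] [_ cv]; apply: is_derive1E => //.
by apply: diff_derivable; exact: smooth_differentiable sc I0.
Qed.

Lemma curve_near x v c : curve_at M x v c -> \forall t \near (0 : R), M (c t).
Proof.
case=> -[I [oI I0 sc Mc]] _; apply: (@filterS _ _ _ I) => //.
exact: open_nbhs_nbhs.
Qed.

Lemma curve_cvg x v c : curve_at M x v c -> c t @[t --> (0 : R)] --> x.
Proof.
case=> -[I [oI I0 sc Mc]] [c0 _]; rewrite -c0.
exact: (smooth_continuous sc I0).
Qed.

(** The chain rule for the local extension F, transferred to g by the fact that a
curve at x stays in M and in U for small times. *)
Lemma dM_curve_ext W (g F : 'rV[R]_3 -> W) (U : set 'rV[R]_3) x v c :
  curve_at M x v c -> open U -> U x -> differentiable F x ->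
  (forall y, M y -> U y -> F y = g y) ->
  is_derive (0 : R) (1 : R) (g \o c) ('D_v F x).
Proof.
move=> cu oU Ux dF Fg.
have dc := curve_is_derive cu.
have [_ [c0 _]] := cu.
have dF0 : differentiable F (c 0) by rewrite c0.
have := is_derive_diff_comp dc dF0; rewrite c0.
apply: near_eq_is_derive.
have nU : \forall t \near (0 : R), U (c t).
  have cc : c t @[t --> (0 : R)] --> x by exact: curve_cvg cu.
  by apply: cc; exact: open_nbhs_nbhs.
by apply: filterS2 nU (curve_near cu) => t Uc Mc /=; exact: Fg.
Qed.

(** The value chosen in [dM] depends neither on the curve nor on the extension. *)
Lemma dM_ext W (g F : 'rV[R]_3 -> W) (U : set 'rV[R]_3) x v :
  tangent M x v -> open U -> U x -> differentiable F x ->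
  (forall y, M y -> U y -> F y = g y) -> dM M g x v = 'D_v F x.
Proof.
move=> [c cu] oU Ux dF Fg.
have key c' : curve_at M x v c' -> is_derive (0 : R) (1 : R) (g \o c') ('D_v F x).
  by move=> cu'; exact: dM_curve_ext Fg.
rewrite /dM.
have : [set d | exists2 c, curve_at M x v c & is_derive (0:R) (1:R) (g \o c) d] ('D_v F x).
  by exists c => //; exact: key.
move=> /(xgetI 0) [c' cu' [_ <-]].
by have [_] := key _ cu'.
Qed.

(** Together with [dM_unique], this reduces each differentiation rule for [dM] to
the corresponding rule for functions of one real variable. *)
Lemma dM_curve W (g : 'rV[R]_3 -> W) x v c : smooth_map M g -> M x ->
  curve_at M x v c -> is_derive (0 : R) (1 : R) (g \o c) (dM M g x v).
Proof.
move=> sg Mx cu; have [U [F [oU Ux sF Fg]]] := sg _ Mx.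
have dF := smooth_differentiable sF Ux.
rewrite (dM_ext (F := F) (U := U)) //; first exact: dM_curve_ext Fg.
by exists c.
Qed.

Lemma dM_unique W (g : 'rV[R]_3 -> W) x v c d : smooth_map M g -> M x ->
  curve_at M x v c -> is_derive (0 : R) (1 : R) (g \o c) d -> dM M g x v = d.
Proof.
by move=> sg Mx cu [_ <-]; have [_ <-] := dM_curve sg Mx cu.
Qed.

Lemma dM_congr W (g h : 'rV[R]_3 -> W) x v :
  (forall y, M y -> g y = h y) -> dM M g x v = dM M h x v.
Proof.
move=> gh; rewrite /dM; congr (xget 0 _); rewrite predeqE => d.
have key (a b : 'rV[R]_3 -> W) : (forall y, M y -> a y = b y) ->
    (exists2 c, curve_at M x v c & is_derive (0:R) (1:R) (a \o c) d) ->
    (exists2 c, curve_at M x v c & is_derive (0:R) (1:R) (b \o c) d).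
  move=> ab [c cu H]; exists c => //; apply: near_eq_is_derive H.
  by apply: filterS (curve_near cu) => t; exact: ab.
by split; apply: key => // y My; rewrite gh.
Qed.

Lemma dMD W (g h : 'rV[R]_3 -> W) x v : smooth_map M g -> smooth_map M h ->
  M x -> tangent M x v ->
  dM M (fun y => g y + h y) x v = dM M g x v + dM M h x v.
Proof.
move=> sg sh Mx [c cu]; apply: (dM_unique _ Mx cu); first exact: smooth_mapD.
exact: is_deriveD (dM_curve sg Mx cu) (dM_curve sh Mx cu).
Qed.

Lemma dM_cst W (k : W) x v : M x -> tangent M x v -> dM M (fun=> k) x v = 0.
Proof.
move=> Mx [c cu]; apply: (dM_unique _ Mx cu); first exact: smooth_map_cst.
exact: is_derive_cst.
Qed.

Lemma dM_lin W (L : {linear 'rV[R]_3 -> W}) x v : continuous L -> M x ->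
  tangent M x v -> dM M L x v = L v.
Proof.
move=> Lc Mx tv; have dL : differentiable L x by exact: linear_differentiable.
rewrite (dM_ext (F := L) (U := setT)) // ?deriveE ?diff_lin //.
exact: openT.
Qed.

Lemma dM_scale W (a : 'rV[R]_3 -> R) (g : 'rV[R]_3 -> W) x v :
  smooth_map M a -> smooth_map M g -> M x -> tangent M x v ->
  dM M (fun y => a y *: g y) x v = dM M a x v *: g x + a x *: dM M g x v.
Proof.
move=> sa sg Mx [c cu]; apply: (dM_unique _ Mx cu); first exact: smooth_mapZ.
have [_ [c0 _]] := cu.
have [da Da] := dM_curve sa Mx cu; have [dg Dg] := dM_curve sg Mx cu.
have {}da : differentiable (a \o c) 0 by exact/derivable1_diffP.
have {}dg : differentiable (g \o c) 0 by exact/derivable1_diffP.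
apply: DeriveDef; first by apply: diff_derivable; exact: differentiable_scale.
by rewrite (@derive_scale _ _ _ (a \o c) (g \o c)) // Da Dg /= c0.
Qed.

Lemma dM_mul (a b : 'rV[R]_3 -> R) x v :
  smooth_map M a -> smooth_map M b -> M x -> tangent M x v ->
  dM M (fun y => a y * b y) x v = dM M a x v * b x + a x * dM M b x v.
Proof. exact: dM_scale. Qed.

Lemma dMN W (g : 'rV[R]_3 -> W) x v : smooth_map M g -> M x ->
  tangent M x v -> dM M (fun y => - g y) x v = - dM M g x v.
Proof.
move=> sg Mx tv; rewrite (@dM_congr _ _ (fun y => (-1 : R) *: g y)); last first.
  by move=> y _; rewrite scaleN1r.
rewrite (@dM_scale _ (fun=> -1)) ?dM_cst //; first by rewrite scale0r add0r scaleN1r.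
exact: smooth_map_cst.
Qed.

Lemma dMB W (g h : 'rV[R]_3 -> W) x v : smooth_map M g -> smooth_map M h ->
  M x -> tangent M x v ->
  dM M (fun y => g y - h y) x v = dM M g x v - dM M h x v.
Proof.
move=> sg sh Mx tv; rewrite dMD ?dMN //; exact: smooth_mapN.
Qed.

Lemma dM_dot (Y Z : 'rV[R]_3 -> 'rV[R]_3) x v :
  smooth_map M Y -> smooth_map M Z -> M x -> tangent M x v ->
  dM M (fun y => dot (Y y) (Z y)) x v = dot (dM M Y x v) (Z x) + dot (Y x) (dM M Z x v).
Proof.
move=> sY sZ Mx [c cu]; apply: (dM_unique _ Mx cu); first exact: smooth_map_dot.
have [_ [c0 _]] := cu.
have := is_derive_dot (dM_curve sY Mx cu) (dM_curve sZ Mx cu).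
by rewrite /= c0.
Qed.

Lemma dM_coord (Y : 'rV[R]_3 -> 'rV[R]_3) i x v : smooth_map M Y -> M x ->
  tangent M x v -> dM M (fun y => Y y 0 i) x v = (dM M Y x v) 0 i.
Proof.
move=> sY Mx [c cu]; apply: (dM_unique _ Mx cu).
  exact: (smooth_map_coordP _ _).1 sY i.
exact: (is_derive_coordP _ _ _).1 (dM_curve sY Mx cu) i.
Qed.

Lemma dM_cross (Y Z : 'rV[R]_3 -> 'rV[R]_3) x v :
  smooth_map M Y -> smooth_map M Z -> M x -> tangent M x v ->
  dM M (fun y => cross (Y y) (Z y)) x v =
  cross (dM M Y x v) (Z x) + cross (Y x) (dM M Z x v).
Proof.
move=> sY sZ Mx tv.
have sYi := (smooth_map_coordP _ _).1 sY; have sZi := (smooth_map_coordP _ _).1 sZ.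
have sYZ : smooth_map M (fun y => cross (Y y) (Z y)) by exact: smooth_map_cross.
have cr i j : dM M (fun y => Y y 0 i * Z y 0 j - Y y 0 j * Z y 0 i) x v =
    dM M Y x v 0 i * Z x 0 j + Y x 0 i * dM M Z x v 0 j -
    (dM M Y x v 0 j * Z x 0 i + Y x 0 j * dM M Z x v 0 i).
  by rewrite dMB ?dM_mul ?dM_coord //; exact: smooth_mapM.
apply: row3P; rewrite -dM_coord // [RHS]mxE !crossE;
  under [in LHS]eq_fun do rewrite crossE; rewrite cr; ring.
Qed.

(** Closedness of the 1-form w |-> <Y, w>, as an identity at one point.  As w
is tangent, only the tangential part of D_v Y enters; for a vector field Y the
condition is the symmetry of v |-> nabla_v Y. *)
Definition curl_free_at (Y : 'rV[R]_3 -> 'rV[R]_3) x :=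
  forall v w, tangent M x v -> tangent M x w ->
    dot (dM M Y x v) w = dot (dM M Y x w) v.

End TangentialDerivative.

(** * The tangent plane *)

Section TangentPlane.
Variable R : realType.

Lemma smooth_line_comp n (W : normedModType R) (U : set 'rV[R]_n) (g : 'rV[R]_n -> W) p xi :
  open U -> smooth U g ->
  open [set t : R | U (p + t *: xi)] /\
  smooth [set t : R | U (p + t *: xi)] (fun t => g (p + t *: xi)).
Proof.
move=> oU sg.
have sl : smooth setT (fun t : R => p + t *: xi).
  apply: smooth_map_open; first exact: openT.
  apply: smooth_mapD; first exact: smooth_map_cst.
  by apply: smooth_mapZ; [exact: smooth_map_id | exact: smooth_map_cst].
have oI : open [set t : R | U (p + t *: xi)].
  apply: (@open_comp _ _ (fun t : R => p + t *: xi)) => // t _.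
  exact: (smooth_continuous sl).
split=> // k; apply: (@Ck_comp _ _ _ _ _ _ U (fun t : R => p + t *: xi) g) => //.
by apply: Ck_sub (sl k).
Qed.

(** The image of a chart of M contributes two independent tangent vectors: the
derivative of the parametrization has a left inverse, the derivative of an
extension of the chart. *)
Lemma chart_tangent (M : set 'rV[R]_3) x (V : set 'rV[R]_3) (U : set 'rV[R]_2) :
  M x -> open V -> V x -> open U -> diffeomorphic (M `&` V) U ->
  exists A : 'M[R]_(2, 3), row_free A /\ forall xi, tangent M x (xi *m A).
Proof.
move=> Mx oV Vx oU [phi [psi [[sphi spsi] [phiU psiM] psiK phiK]]].
have {}spsi : smooth U psi by exact: smooth_map_open.
pose p := phi x.
have Up : U p by exact: phiU.
have psip : psi p = x by exact: psiK.
have dpsi : differentiable psi p by exact: smooth_differentiable spsi Up.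
exists (jacobian psi p); split; last first.
  move=> xi; rewrite -deriveEjacobian //.
  exists (fun t => psi (p + t *: xi)); split.
    exists [set t : R | U (p + t *: xi)].
    have [oI sI] := smooth_line_comp p xi oU spsi.
    split=> //; first by rewrite /= scale0r addr0.
    by move=> t /psiM[].
  have dpsi0 : differentiable psi (p + 0 *: xi) by rewrite scale0r addr0.
  rewrite scale0r addr0; split=> //; rewrite derive1E.
  have [_ ->] := is_derive_along dpsi0.
  by rewrite scale0r addr0.
have [U' [F [oU' U'x sF Fphi]]] := sphi _ (conj Mx Vx).
have dF : differentiable F x by exact: smooth_differentiable sF U'x.
have dF' : differentiable F (psi p) by rewrite psip.
apply/row_freeP; exists (jacobian F x).
apply/row_matrixP => i; rewrite row_mul rowE -deriveEjacobian //.
rewrite -deriveEjacobian // -[in LHS]psip -derive_comp //.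
have nid : \forall u \near p, id u = (F \o psi) u.
  have nU' : \forall u \near p, U' (psi u).
    have cp : psi u @[u --> p] --> psi p by exact: differentiable_continuous.
    by apply: cp; rewrite psip; apply: open_nbhs_nbhs.
  have nU : \forall u \near p, U u by exact: open_nbhs_nbhs.
  by apply: filterS2 nU nU' => u Uu U'u /=; rewrite Fphi ?phiK //; exact: psiM.
rewrite -(near_eq_derive _ nid) derive_id.
by rewrite row1.
Qed.

(** The tangent plane is orthogonal to nu and contains a two-dimensional space,
which fills the orthogonal complement of nu. *)
Lemma tangentE (M : set 'rV[R]_3) (nu : 'rV[R]_3 -> 'rV[R]_3) x v :
  smooth_surface M -> outward_unit_normal M nu -> M x ->
  tangent M x v <-> dot (nu x) v = 0.
Proof.
move=> surf [_ nuP] Mx; have [nu1 nuT _] := nuP _ Mx; split; first exact: nuT.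
move=> nuv; have [V [U [oV Vx oU dif]]] := surf _ Mx.
have [A [Afree At]] := chart_tangent Mx oV Vx oU dif.
have Aker : (A <= kermx (nu x)^T)%MS.
  apply/sub_kermxP; apply/row_matrixP => i; rewrite row_mul row0.
  have := nuT _ (At (delta_mx 0 i)).
  rewrite -rowE dotC /dot => E; apply/rowP => j; rewrite (ord1 j) E mxE //.
have rk : \rank (kermx (nu x)^T) = 2%N.
  rewrite mxrank_ker mxrank_tr rank_rV.
  suff -> : nu x != 0 by [].
  by apply/eqP => n0; move: nu1; rewrite n0 dot0l => /eqP; rewrite eq_sym oner_eq0.
have kA : (kermx (nu x)^T <= A)%MS.
  have := mxrank_leqif_eq Aker; rewrite rk (eqP Afree) => -[_].
  by rewrite eqxx => /esym /eqmxP ->.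
have : (v <= kermx (nu x)^T)%MS.
  apply/sub_kermxP; apply/rowP => j; rewrite (ord1 j) [RHS]mxE.
  have -> : (v *m (nu x)^T) 0 0 = dot v (nu x) by [].
  by rewrite dotC nuv.
move=> /submx_trans -/(_ _ _ kA) /submxP[xi ->].
exact: At.
Qed.

End TangentPlane.

(** * Levi-Civita connection, shape operator and Hessian *)

Section SurfaceGeometry.
Variables (R : realType) (M : set 'rV[R]_3) (nu : 'rV[R]_3 -> 'rV[R]_3).
Hypotheses (M_surface : smooth_surface M) (nu_normal : outward_unit_normal M nu).
Implicit Types (x v w : 'rV[R]_3) (X Y Z : 'rV[R]_3 -> 'rV[R]_3).

Lemma smooth_nu : smooth_map M nu.
Proof. by case: nu_normal. Qed.
Hint Resolve smooth_nu : core.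

Lemma nu_unit x : M x -> dot (nu x) (nu x) = 1.
Proof. by case: nu_normal => _ H /H[]. Qed.

Lemma tanP x v : M x -> tangent M x v <-> dot (nu x) v = 0.
Proof. exact: tangentE. Qed.

Lemma tangent_lin x k v w : M x -> tangent M x v -> tangent M x w ->
  tangent M x (k *: v + w).
Proof. by move=> Mx; rewrite !tanP // dotDr dotZr => -> ->; rewrite mulr0 addr0. Qed.

Lemma tangent0 x : M x -> tangent M x 0.
Proof. by move=> Mx; rewrite tanP // dot0r. Qed.

Lemma tangentZ x k v : M x -> tangent M x v -> tangent M x (k *: v).
Proof. by move=> Mx; rewrite !tanP // dotZr => ->; rewrite mulr0. Qed.

Lemma tangentB x v w : M x -> tangent M x v -> tangent M x w -> tangent M x (v - w).
Proof. by move=> Mx; rewrite !tanP // dotBr => -> ->; rewrite subr0. Qed.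

Lemma tangent_cross x v : M x -> tangent M x (cross (nu x) v).
Proof. by move=> Mx; rewrite tanP // dot_crossl. Qed.

Lemma tangent_eq x a b : M x -> tangent M x a -> tangent M x b ->
  (forall w, tangent M x w -> dot a w = dot b w) -> a = b.
Proof.
move=> Mx ta tb H; apply/eqP; rewrite -subr_eq0; apply/eqP/dot_self_eq0.
by rewrite dotBl H ?subrr //; exact: tangentB.
Qed.

(** The orthogonal projection to the tangent plane.  For a fixed w it is a tangent
field, which extends any given tangent vector w to a vector field on M. *)
Definition tproj (w : 'rV[R]_3) (y : 'rV[R]_3) := w - dot w (nu y) *: nu y.

Lemma tproj_tangent w x : M x -> tangent M x (tproj w x).
Proof. by move=> Mx; rewrite tanP // /tproj dotBr dotZr nu_unit // mulr1 dotC subrr. Qed.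

Lemma tproj_id w x : M x -> tangent M x w -> tproj w x = w.
Proof. by move=> Mx; rewrite tanP // /tproj dotC => ->; rewrite scale0r subr0. Qed.

Lemma dot_tproj w x v : M x -> tangent M x v -> dot (tproj w x) v = dot w v.
Proof. by move=> Mx; rewrite tanP // /tproj dotBl dotZl => ->; rewrite mulr0 subr0. Qed.

Lemma smooth_tproj Y : smooth_map M Y -> smooth_map M (fun y => tproj (Y y) y).
Proof.
move=> sY; apply: smooth_mapB => //; apply: smooth_mapZ => //.
exact: smooth_map_dot.
Qed.

Lemma tproj_field w : vector_field M (tproj w).
Proof.
split; last by move=> x; exact: tproj_tangent.
by apply: (smooth_tproj (Y := fun=> w)); exact: smooth_map_cst.
Qed.

Lemma dM_const_on (W : normedModType R) (g : 'rV[R]_3 -> W) (k : W) x v : M x -> tangent M x v ->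
  (forall y, M y -> g y = k) -> dM M g x v = 0.
Proof. by move=> Mx tv gk; rewrite (@dM_congr _ _ _ g (fun=> k)) ?dM_cst. Qed.

Lemma dM_nu_tangent x v : M x -> tangent M x v -> tangent M x (dM M nu x v).
Proof.
move=> Mx tv; rewrite tanP //.
have := @dM_const_on _ (fun y => dot (nu y) (nu y)) 1 x v Mx tv (fun y => @nu_unit y).
rewrite dM_dot // dotC -mulr2n => /eqP; rewrite mulrn_eq0 /= => /eqP //.
Qed.

Lemma dM_nu_dot Y x v : vector_field M Y -> M x -> tangent M x v ->
  dot (dM M nu x v) (Y x) = - dot (nu x) (dM M Y x v).
Proof.
move=> [sY tY] Mx tv.
have H y : M y -> dot (nu y) (Y y) = 0 by move=> My; apply/tanP => //; exact: tY.
have := dM_const_on Mx tv H; rewrite dM_dot // => /eqP.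
by rewrite addr_eq0 => /eqP.
Qed.

Section Connection.
Variable nabla : ('rV[R]_3 -> 'rV[R]_3) -> 'rV[R]_3 -> 'rV[R]_3 -> 'rV[R]_3.
Hypothesis nablaLC : levi_civita M nabla.

Lemma nabla_tangent Y x v : vector_field M Y -> M x -> tangent M x v ->
  tangent M x (nabla Y x v).
Proof.
move=> vY Mx tv; have [[H _ _ _] _ _] := nablaLC.
have [_ /(_ x Mx)] := H _ _ (tproj_field v) vY.
by rewrite tproj_id.
Qed.

(** Torsion-freeness applied to the coordinate functions of the ambient space, on
which fields act through their components. *)
Lemma torsion_freeE X Y x : vector_field M X -> vector_field M Y -> M x ->
  nabla Y x (X x) - nabla X x (Y x) = dM M Y x (X x) - dM M X x (Y x).
Proof.
move=> vX vY Mx; have [_ tf _] := nablaLC.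
have [sX tX] := vX; have [sY tY] := vY.
apply/rowP => i.
have ci := @coordl_continuous R _ i.
have sc : smooth_map M (coordl R i) by exact: smooth_map_lin.
have dc (Z : 'rV[R]_3 -> 'rV[R]_3) w : vector_field M Z -> tangent M x w ->
    dM M (fun y => dM M (coordl R i) y (Z y)) x w = dM M Z x w 0 i.
  move=> [sZ tZ] tw; rewrite -dM_coord //; apply: dM_congr => y My.
  by rewrite dM_lin //; exact: tZ.
have := tf X Y (coordl R i) x vX vY sc Mx.
have tXx := tX x Mx; have tYx := tY x Mx.
have tN : tangent M x (nabla Y x (X x) - nabla X x (Y x)).
  by apply: tangentB => //; exact: nabla_tangent.
rewrite !dc // dM_lin // => E.
by rewrite [RHS]mxE [X in _ = _ + X]mxE -E.
Qed.

(** Koszul's argument.  The difference nabla_X Y - D_X Y is symmetric in X and Y,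
by [torsion_freeE], and its inner product with Z is antisymmetric in Y and Z,
by compatibility with the metric; a trilinear form with both symmetries
vanishes. *)
Lemma nablaE Y x v w : vector_field M Y -> M x -> tangent M x v -> tangent M x w ->
  dot (nabla Y x v) w = dot (dM M Y x v) w.
Proof.
move=> vY Mx tv tw; have [_ _ mc] := nablaLC.
pose a X Y Z := dot (nabla Y x (X x) - dM M Y x (X x)) (Z x).
have sym X Y' Z : vector_field M X -> vector_field M Y' -> a X Y' Z = a Y' X Z.
  move=> vX vY'; apply/eqP; rewrite -subr_eq0 /a -dotBl.
  rewrite (_ : _ - _ - _ = (nabla Y' x (X x) - nabla X x (Y' x)) - (dM M Y' x (X x) - dM M X x (Y' x))).
    by rewrite torsion_freeE // subrr dot0l.
  by rewrite opprB opprB addrACA [RHS]addrACA; congr (_ + _); rewrite addrC.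
have skew X Y' Z : vector_field M X -> vector_field M Y' -> vector_field M Z ->
    a X Y' Z = - a X Z Y'.
  move=> vX vY' vZ; have [sY' _] := vY'; have [sZ _] := vZ; have [_ tX] := vX.
  have := mc Y' Z x (X x) vY' vZ Mx (tX _ Mx).
  rewrite dM_dot //; last exact: tX.
  by rewrite /a !dotBl ![dot (Y' x) _]dotC => E; lra.
have vV := tproj_field v; have vW := tproj_field w.
have : a (tproj v) Y (tproj w) = 0.
  (* a X Y Z = - a X Z Y = - a Z X Y = a Z Y X = a Y Z X = - a Y X Z = - a X Y Z *)
  have E : a (tproj v) Y (tproj w) = - a (tproj v) Y (tproj w).
    rewrite {1}skew // sym // skew // opprK sym // skew // sym //.
  lra.
by rewrite /a !tproj_id // dotBl => /eqP; rewrite subr_eq0 => /eqP.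
Qed.

(** The bracket D_X Y - D_Y X is tangent, so its normal component, which compares
the two sides, vanishes. *)
Lemma shape_sym x v w : M x -> tangent M x v -> tangent M x w ->
  dot (dM M nu x v) w = dot (dM M nu x w) v.
Proof.
move=> Mx tv tw; have vV := tproj_field v; have vW := tproj_field w.
have E1 := dM_nu_dot vW Mx tv; have E2 := dM_nu_dot vV Mx tw.
rewrite !tproj_id // in E1 E2; rewrite E1 E2; congr (- _).
apply/eqP; rewrite -subr_eq0 -dotBr; apply/eqP.
have := torsion_freeE vV vW Mx; rewrite !tproj_id // => <-.
by apply/tanP => //; apply: tangentB => //; exact: nabla_tangent.
Qed.

(** X (Y h) - Y (X h) is computed once from the product rule for <G, Y> and
<G, X>, and once from torsion-freeness; the first-order terms cancel. *)
Lemma hessian_sym (h : 'rV[R]_3 -> R) G x v w :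
  smooth_map M h -> vector_field M G ->
  (forall y a, M y -> tangent M y a -> dM M h y a = dot (G y) a) ->
  M x -> tangent M x v -> tangent M x w ->
  dot (dM M G x v) w = dot (dM M G x w) v.
Proof.
move=> sh [sG tG] hG Mx tv tw; have [_ tf _] := nablaLC.
have vV := tproj_field v; have vW := tproj_field w.
have [[sV tV] [sW tW]] := (vV, vW).
have := tf _ _ h x vV vW sh Mx.
have dh (Z : 'rV[R]_3 -> 'rV[R]_3) a : vector_field M Z -> tangent M x a ->
    dM M (fun y => dM M h y (Z y)) x a = dot (dM M G x a) (Z x) + dot (G x) (dM M Z x a).
  move=> [sZ tZ] ta; rewrite -dM_dot //; apply: dM_congr => y My.
  by rewrite hG //; exact: tZ.
rewrite hG //; last by apply: tangentB => //; apply: nabla_tangent => //; rewrite ?tproj_id.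
rewrite torsion_freeE // !tproj_id // !dh // !tproj_id // dotBr.
lra.
Qed.

End Connection.
End SurfaceGeometry.

(** * Gradients on a surface *)

Section Gradient.
Variables (R : realType) (M : set 'rV[R]_3) (nu : 'rV[R]_3 -> 'rV[R]_3).
Hypotheses (M_surface : smooth_surface M) (nu_normal : outward_unit_normal M nu).

Lemma grad_eq (g : 'rV[R]_3 -> R) x w : M x -> tangent M x w ->
  (forall v, tangent M x v -> dot w v = dM M g x v) -> grad M g x = w.
Proof.
move=> Mx tw wg; rewrite /grad.
have : [set w | tangent M x w /\ forall v, tangent M x v -> dot w v = dM M g x v] w by [].
move=> /(xgetI 0) [t H].
by apply: (tangent_eq M_surface nu_normal Mx) => // v tv; rewrite H // wg.
Qed.

(** The Euclidean gradient of an extension.  Its tangential projection is smooth,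
which shows that the gradient on M is. *)
Definition ambient_grad (F : 'rV[R]_3 -> R) (y : 'rV[R]_3) : 'rV[R]_3 :=
  \row_i 'D_(delta_mx 0 i) F y.

Lemma dot_ambient_grad F y v : differentiable F y ->
  dot (ambient_grad F y) v = 'D_v F y.
Proof.
move=> dF; rewrite derive_basis // dotE; apply: eq_bigr => i _.
by rewrite mxE mulrC.
Qed.

Lemma grad_ext (g F : 'rV[R]_3 -> R) (U : set 'rV[R]_3) x : M x -> open U -> U x ->
  differentiable F x -> (forall y, M y -> U y -> F y = g y) ->
  grad M g x = tproj nu (ambient_grad F x) x.
Proof.
move=> Mx oU Ux dF Fg; apply: grad_eq => //; first exact: tproj_tangent.
move=> v tv; rewrite (dot_tproj M_surface nu_normal) // dot_ambient_grad //.
by rewrite (dM_ext (F := F) (U := U)).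
Qed.

Lemma grad_dM (g : 'rV[R]_3 -> R) x v : smooth_map M g -> M x -> tangent M x v ->
  dM M g x v = dot (grad M g x) v.
Proof.
move=> sg Mx tv; have [U [F [oU Ux sF Fg]]] := sg _ Mx.
have dF := smooth_differentiable sF Ux.
rewrite (grad_ext Mx oU Ux dF Fg) (dot_tproj M_surface nu_normal) //.
by rewrite dot_ambient_grad // (dM_ext (F := F) (U := U)).
Qed.

Lemma grad_field (g : 'rV[R]_3 -> R) : smooth_map M g -> vector_field M (grad M g).
Proof.
move=> sg; split=> x Mx; have [U [F [oU Ux sF Fg]]] := sg _ Mx; last first.
  have dF := smooth_differentiable sF Ux.
  by rewrite (grad_ext Mx oU Ux dF Fg); exact: tproj_tangent.
have [snu _] := nu_normal.
have [V [N [oV Vx sN Nnu]]] := snu _ Mx.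
have oUV : open (U `&` V) by exact: openI.
have sF' : smooth_map (U `&` V) (ambient_grad F).
  apply/smooth_map_coordP => i.
  under eq_fun do rewrite mxE.
  exact: smooth_smooth_map oU (@subIsetl _ U V) (smooth_derive _ sF).
have sN' : smooth_map (U `&` V) N.
  exact: smooth_smooth_map oV (@subIsetr _ U V) sN.
exists (U `&` V), (fun y => tproj N (ambient_grad F y) y); split=> //.
  apply: smooth_map_open => //.
  apply: smooth_mapB => //; apply: smooth_mapZ => //; exact: smooth_map_dot.
move=> y My [Uy Vy]; have dF := smooth_differentiable sF Uy.
by rewrite (grad_ext My oU Uy dF Fg) /tproj Nnu.
Qed.

End Gradient.

(** * The rotation field *)

Section Rotation.
Variable R : realType.
Implicit Types x v : 'rV[R]_3.

Definition e3 : 'rV[R]_3 := vec3 0 0 1.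

Definition rotation_field x := cross e3 x.

Lemma dot_rotation v w : dot (rotation_field v) w = - dot v (rotation_field w).
Proof. by rewrite /rotation_field [LHS]dotC dot_cross_cyc dot_cross_cyc crossC dotNr. Qed.

Lemma rotation_field_sqr x : dot (rotation_field x) (rotation_field x) = x 0 0 ^+ 2 + x 0 1 ^+ 2.
Proof. by rewrite dot3E /rotation_field !crossE !vec3E; ring. Qed.

Lemma is_derive_cosE (a : R) (t : R) : is_derive t (1 : R) (fun t => cos t * a) (- sin t * a).
Proof.
have H := is_derive_mul (is_derive_cos t) (is_derive_cst (a : R) t 1).
by apply: is_derive_eq H _; rewrite mulr0 addr0.
Qed.

Lemma is_derive_sinE (a : R) (t : R) : is_derive t (1 : R) (fun t => sin t * a) (cos t * a).
Proof.
have H := is_derive_mul (is_derive_sin t) (is_derive_cst (a : R) t 1).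
by apply: is_derive_eq H _; rewrite mulr0 addr0.
Qed.

Lemma is_derive_rot3 x (t : R) :
  is_derive t (1 : R) (fun t => rot3 t x) (rot3 t (rotation_field x)).
Proof.
apply/is_derive_coordP => -[[|[|[|//]]] lti].
- rewrite (_ : (fun s => _) = (fun s => cos s * x 0 0 - sin s * x 0 1)); last first.
    by rewrite funeqE => s; rewrite mxE.
  have H := is_deriveB (is_derive_cosE (x 0 0) t) (is_derive_sinE (x 0 1) t).
  apply: is_derive_eq H _.
  by rewrite mxE /= /rotation_field !crossE !vec3E; ring.
- rewrite (_ : (fun s => _) = (fun s => sin s * x 0 0 + cos s * x 0 1)); last first.
    by rewrite funeqE => s; rewrite mxE.
  have H := is_deriveD (is_derive_sinE (x 0 0) t) (is_derive_cosE (x 0 1) t).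
  apply: is_derive_eq H _.
  by rewrite mxE /= /rotation_field !crossE !vec3E; ring.
- rewrite (_ : (fun s => _) = (fun=> x 0 2)); last first.
    by rewrite funeqE => s; rewrite mxE.
  apply: is_derive_eq (is_derive_cst _ _ _) _.
  by rewrite mxE /= /rotation_field !crossE !vec3E; ring.
Qed.

Lemma rot30 x : rot3 0 x = x.
Proof. by apply: row3P; rewrite !mxE /= ?cos0 ?sin0; ring. Qed.

Lemma X3E x : X3 x = rotation_field x.
Proof. by rewrite /X3 derive1E; have [_ ->] := is_derive_rot3 x 0; rewrite rot30. Qed.

(** On the real line a derivative in direction v is v times the usual one; needed
because [Ck] quantifies over all directions, even in dimension one. *)
Lemma derive1_R (f df : R -> R) : (forall t, is_derive t (1 : R) f (df t)) ->
  forall v t : R, 'D_v f t = v *: df t.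
Proof.
move=> H v t; have [d D] := H t; have dt := (derivable1_diffP _ _).1 d.
rewrite deriveE // -[v in LHS]mulr1 -[v * 1]/(v *: (1 : R)) linearZ /= -deriveE //.
by rewrite D.
Qed.

Lemma Ck_cos_sin k : Ck k setT (@cos R) /\ Ck k setT (@sin R).
Proof.
elim: k => [|k [IHc IHs]].
  by split=> x _; [exact: continuous_cos | exact: continuous_sin].
split; split=> [x _|v].
- by apply/derivable1_diffP; have [] := is_derive_cos x.
- rewrite (_ : 'D_v (@cos R) = fun t : R => (- v) *: sin t).
    by apply: CkZ => //; [exact: openT | exact: Ck_cst].
  rewrite funeqE => t; rewrite (derive1_R (@is_derive_cos R)) scalerN scaleNr //.
- by apply/derivable1_diffP; have [] := is_derive_sin x.
- rewrite (_ : 'D_v (@sin R) = fun t : R => v *: cos t).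
    by apply: CkZ => //; [exact: openT | exact: Ck_cst].
  by rewrite funeqE => t; rewrite (derive1_R (@is_derive_sin R)).
Qed.

Lemma smooth_rot3 x : smooth setT (fun t : R => rot3 t x).
Proof.
have sc : smooth_map setT (@cos R).
  apply: (@smooth_smooth_map _ _ _ _ setT) => //; first exact: openT.
  by move=> k; have [] := Ck_cos_sin k.
have ss : smooth_map setT (@sin R).
  apply: (@smooth_smooth_map _ _ _ _ setT) => //; first exact: openT.
  by move=> k; have [] := Ck_cos_sin k.
apply: smooth_map_open; first exact: openT.
have cc (k : R) : smooth_map setT (fun _ : R => k) by exact: smooth_map_cst.
by apply: smooth_map_vec3 => //; [apply: smooth_mapB|apply: smooth_mapD]; exact: smooth_mapM.
Qed.

Lemma rotation_tangent (M : set 'rV[R]_3) x : radially_symmetric M -> M x ->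
  tangent M x (rotation_field x).
Proof.
move=> radM Mx; exists (fun t => rot3 t x); split; last first.
  split; first exact: rot30.
  by rewrite -X3E.
exists setT; split=> //; [exact: openT | exact: smooth_rot3 | ].
by move=> t _; rewrite -(radM t); exists x.
Qed.

End Rotation.

(** * The zonal flow *)

Section ZonalFlow.
Variables (R : realType) (M : set 'rV[R]_3) (nu : 'rV[R]_3 -> 'rV[R]_3)
  (nabla : ('rV[R]_3 -> 'rV[R]_3) -> 'rV[R]_3 -> 'rV[R]_3 -> 'rV[R]_3)
  (f : 'rV[R]_3 -> R) (u : 'rV[R]_3 -> 'rV[R]_3).
Hypotheses (M_surface : smooth_surface M) (nu_normal : outward_unit_normal M nu)
  (nablaLC : levi_civita M nabla) (f_smooth : smooth_map M f)
  (u_def : forall x, M x -> u x = rotJ nu x (grad M f x)).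
Implicit Types (x v w : 'rV[R]_3).

Let G := grad M f.
Let snu : smooth_map M nu := smooth_nu nu_normal.
Let vG : vector_field M G := grad_field M_surface nu_normal f_smooth.
Let sG : smooth_map M G := vG.1.
Let tG x (Mx : M x) : tangent M x (G x) := vG.2 x Mx.
Let tP x v (Mx : M x) := tanP M_surface nu_normal v Mx.
Let nu1 x (Mx : M x) : dot (nu x) (nu x) = 1 := nu_unit nu_normal Mx.

Lemma stream_field : vector_field M u.
Proof.
split.
  apply: (@smooth_map_eq _ _ _ _ (fun y => cross (nu y) (G y))).
    by move=> y My; rewrite u_def.
  exact: smooth_map_cross.
by move=> x Mx; rewrite u_def //; exact: tangent_cross.
Qed.
Let vu := stream_field.
Let su : smooth_map M u := vu.1.
Let tu x (Mx : M x) : tangent M x (u x) := vu.2 x Mx.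

Lemma dM_stream x v : M x -> tangent M x v ->
  dM M u x v = cross (dM M nu x v) (G x) + cross (nu x) (dM M G x v).
Proof.
move=> Mx tv; rewrite -dM_cross //; apply: dM_congr => y My.
by rewrite u_def.
Qed.

Lemma stream_grad_sym x v w : M x -> tangent M x v -> tangent M x w ->
  dot (dM M G x v) w = dot (dM M G x w) v.
Proof.
move=> Mx tv tw.
apply: (hessian_sym M_surface nu_normal nablaLC f_smooth vG) => //.
by move=> y a My ta; rewrite (grad_dM M_surface nu_normal).
Qed.

(** With b = c (nu x a) and c^2 = 1, the two diagonal entries of the derivative
of u are opposite off-diagonal entries of the Hessian of f.  The term
(D_v nu) x G is normal and does not contribute. *)
Lemma divergence_stream x : M x -> divergence M nabla u x = 0.
Proof.
move=> Mx; rewrite /divergence /mxtrace !big_ord_recl big_ord0 addr0 /tangent_mx.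
set e := xget _ _; rewrite !mxE.
(* Without an orthonormal frame, e is the default value 0 and the trace is 0. *)
have [[te eo]|] := boolp.EM (orthonormal_frame M x e); last first.
  rewrite {2}/e => ne; have -> : e = 0.
    rewrite /e; case: xgetP => // y _ Hy; case: ne.
    exact: (xgetI 0 Hy).
  by rewrite !row0 !dot0r addr0.
have ee i j : dot (row i e) (row j e) = (i == j)%:R.
  have -> : dot (row i e) (row j e) = (e *m e^T) i j.
    by rewrite dotE [RHS]mxE; apply: eq_bigr => k _; rewrite !mxE.
  by rewrite eo mxE.
have -> : lift ord0 ord0 = 1 :> 'I_2 by exact: val_inj.
have -> : ord0 = 0 :> 'I_2 by [].
set a := row 0 e; set b := row 1 e.
have ta : tangent M x a by exact: te.
have tb : tangent M x b by exact: te.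
rewrite !(nablaE M_surface nu_normal nablaLC vu) //.
have na := (tP a Mx).1 ta; have nb := (tP b Mx).1 tb.
have aa : dot a a = 1 by rewrite ee.
have bb : dot b b = 1 by rewrite ee.
have ba : dot b a = 0 by rewrite ee.
pose L := cross (nu x) a; pose c := dot b L.
have bE : b = c *: L.
  have := tangent_frame (nu1 Mx) nb na.
  by rewrite aa scale1r ba scale0r add0r.
have LL : dot L L = 1 by rewrite dot_cross_cross nu1 // aa na mul0r subr0 mulr1.
have cc : c * c = 1.
  by move: bb; rewrite bE dotZl dotZr LL mulr1.
have key v : tangent M x v -> dot (dM M u x v) v = - dot (dM M G x v) (cross (nu x) v).
  move=> tv; rewrite dM_stream // dotC dotDr.
  rewrite (triple_tangent (nu1 Mx)) ?add0r.
  - by rewrite dot_cross_cyc dot_cross_cyc crossC dotNr.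
  - exact: (tP v Mx).1.
  - by apply/(tP _ Mx); exact: dM_nu_tangent.
  - by apply/(tP _ Mx); exact: tG.
rewrite !key // -/L.
have -> : cross (nu x) b = - c *: a.
  by rewrite bE crossZr triple_product na scale0r sub0r nu1 // scale1r scalerN scaleNr.
rewrite dotZr [X in - (_ * X)](stream_grad_sym Mx tb ta) bE dotZr.
by rewrite mulNr opprK mulrA cc mul1r addNr.
Qed.

Hypotheses (M_radial : radially_symmetric M) (f_zonal : zonal M f).

Local Notation K := (@rotation_field R).
Let r2 y := dot (K y) (K y).
Let s y := dot (u y) (K y).
Let C y := nabla u y (u y).

Lemma smooth_rotation_field : smooth_map M K.
Proof. by apply: smooth_map_cross; [exact: smooth_map_cst | exact: smooth_map_id]. Qed.
Let sK := smooth_rotation_field.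

Lemma rotation_vector_field : vector_field M K.
Proof. by split=> // x; exact: rotation_tangent. Qed.
Let vK := rotation_vector_field.
Let tK x (Mx : M x) : tangent M x (K x) := vK.2 x Mx.

Lemma dM_rotation x v : M x -> tangent M x v -> dM M K x v = K v.
Proof.
move=> Mx tv; rewrite dM_cross //; [|exact: smooth_map_cst|exact: smooth_map_id].
rewrite dM_cst // (@dM_lin _ _ _ idfun) //=; last by move=> y.
by rewrite -(scale0r 0) crossZl scale0r add0r.
Qed.

(** The infinitesimal form of the rotation equivariance of the normal, obtained
without integrating the rotation: D_K nu and K nu are both tangent, and have
the same inner product with every tangent w, by symmetry of the shape operator
and the derivative of <nu, K> = 0 along w. *)
Lemma dM_nu_rotation x : M x -> dM M nu x (K x) = K (nu x).
Proof.
move=> Mx; have tKx := tK Mx; apply: (tangent_eq M_surface nu_normal Mx).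
- exact: dM_nu_tangent.
- by apply/(tP _ Mx); rewrite /rotation_field dot_crossr.
move=> w tw; rewrite (shape_sym M_surface nu_normal nablaLC) //.
rewrite (dM_nu_dot M_surface nu_normal) // dM_rotation //.
by rewrite dot_rotation.
Qed.

Lemma dM_chi_rotation x : M x -> dM M (chi nu) x (K x) = 0.
Proof.
move=> Mx; have tKx := tK Mx.
rewrite /chi (@dM_dot _ _ (fun=> e3 R)) //; last exact: smooth_map_cst.
by rewrite dM_cst // dot0l add0r dM_nu_rotation // dot_crossl.
Qed.

Lemma dot_grad_rotation x : M x -> dot (G x) (K x) = 0.
Proof.
move=> Mx; have := f_zonal Mx; rewrite X3E (grad_dM M_surface nu_normal) //.
exact: tK.
Qed.

(** s = <G, N> with N = K x nu.  Its derivative along K is, by symmetry of the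
Hessian and since <G, K> = 0, the inner product of G with the bracket of K and
N, which vanishes because both nu and K are invariant under rotation. *)
Lemma dM_momentum_rotation x : M x -> dM M s x (K x) = 0.
Proof.
move=> Mx; pose N y := cross (K y) (nu y).
have sN : smooth_map M N by exact: smooth_map_cross.
have tN y : M y -> tangent M y (N y) by move=> My; apply/(tP _ My); rewrite dot_crossr.
have tKx := tK Mx; have tNx := tN x Mx.
rewrite (@dM_congr _ _ _ _ (fun y => dot (G y) (N y))); last first.
  by move=> y My; rewrite /s u_def // dotC dot_cross_cyc dot_cross_cyc.
rewrite dM_dot // (stream_grad_sym Mx tKx tNx).
have H : dot (dM M G x (N x)) (K x) + dot (G x) (K (N x)) = 0.
  rewrite -(dM_rotation Mx tNx) -dM_dot //.
  by apply: (dM_const_on (k := 0)) => // y; exact: dot_grad_rotation.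
have -> : dM M N x (K x) = K (N x); last by [].
rewrite dM_cross // dM_rotation // dM_nu_rotation //.
exact: esym (cross_jacobi _ (K x) (nu x)).
Qed.

(** u is orthogonal to nu x K because G is orthogonal to K.  Away from the poles,
s / r2 is thus the angular velocity of the flow; multiplying by powers of r2
keeps all functions smooth at the poles. *)
Lemma stream_parallel_rotation x : M x -> r2 x *: u x = s x *: K x.
Proof.
move=> Mx; have tux := (tP _ Mx).1 (tu Mx); have tKx := (tP _ Mx).1 (tK Mx).
rewrite /r2 (tangent_frame (nu1 Mx) tux tKx).
have -> : dot (u x) (cross (nu x) (K x)) = 0.
  by rewrite u_def // dot_cross_cross -/G dot_grad_rotation // mulr0 tKx mul0r subr0.
by rewrite scale0r addr0.
Qed.

Let sr2 : smooth_map M r2. Proof. exact: smooth_map_dot. Qed.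
Let ss : smooth_map M s. Proof. exact: smooth_map_dot. Qed.

Lemma dM_r2 x v : M x -> tangent M x v -> dM M r2 x v = - (2 * dot (K (K x)) v).
Proof.
move=> Mx tv; rewrite dM_dot // dM_rotation // [dot (K x) _]dotC -mulr2n.
by rewrite dot_rotation dotC mulNrn mulr_natl.
Qed.

Lemma dM_r2_rotation x : M x -> dM M r2 x (K x) = 0.
Proof.
move=> Mx; rewrite dM_r2 //; last exact: tK.
by rewrite dotC dot_crossr mulr0 oppr0.
Qed.

Lemma dMZ x (h : 'rV[R]_3 -> R) k v : smooth_map M h -> M x -> tangent M x v ->
  dM M h x (k *: v) = k * dM M h x v.
Proof.
move=> sh Mx tv; have t0 := tangent0 M_surface nu_normal Mx.
have tkv := tangentZ M_surface nu_normal k Mx tv.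
rewrite !(grad_dM M_surface nu_normal) // dotZr //.
Qed.

(** Differentiate r2 u = s K along u.  The derivatives of r2 and s along u vanish
after multiplication by r2, since r2 u is a multiple of K. *)
Lemma acceleration x : M x -> r2 x ^+ 2 *: dM M u x (u x) = s x ^+ 2 *: K (K x).
Proof.
move=> Mx; have tux := tu Mx; have tKx := tK Mx.
have dr : r2 x * dM M r2 x (u x) = 0.
  by rewrite -dMZ // stream_parallel_rotation // dMZ // dM_r2_rotation // mulr0.
have ds : r2 x * dM M s x (u x) = 0.
  by rewrite -dMZ // stream_parallel_rotation // dMZ // dM_momentum_rotation // mulr0.
have E : dM M r2 x (u x) *: u x + r2 x *: dM M u x (u x) =
         dM M s x (u x) *: K x + s x *: K (u x).
  by rewrite -dM_scale // -(dM_rotation Mx tux) -dM_scale //; apply: dM_congr; exact: stream_parallel_rotation.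
have := congr1 (fun z => r2 x *: z) E.
rewrite !scalerDr !scalerA dr ds !scale0r !add0r -expr2 => ->.
rewrite [r2 x * s x]mulrC -scalerA /rotation_field -crossZr -/(rotation_field _) stream_parallel_rotation // /rotation_field.
by rewrite crossZr scalerA.
Qed.

Lemma accel_field : vector_field M C.
Proof. by have [[H _ _ _] _ _] := nablaLC; exact: H. Qed.
Let vC := accel_field.
Let sC : smooth_map M C := vC.1.
Let tC x (Mx : M x) : tangent M x (C x) := vC.2 x Mx.

Let B y := tproj nu (K (K y)) y.
Let sKK : smooth_map M (fun y => K (K y)).
Proof. by apply: smooth_map_cross => //; exact: smooth_map_cst. Qed.
Let sB : smooth_map M B := smooth_tproj nu_normal sKK.
Let tB x (Mx : M x) : tangent M x (B x) := tproj_tangent M_surface nu_normal (K (K x)) Mx.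

(** Motion on circles: the acceleration is centripetal, equal to the squared
angular velocity times the tangential part B of K (K y). *)
Lemma accelE x : M x -> r2 x ^+ 2 *: C x = s x ^+ 2 *: B x.
Proof.
move=> Mx; have tux := tu Mx.
apply: (tangent_eq M_surface nu_normal Mx).
- by apply: (tangentZ M_surface nu_normal) => //; exact: tC.
- by apply: (tangentZ M_surface nu_normal) => //; exact: tB.
move=> w tw; rewrite !dotZl (dot_tproj M_surface nu_normal) //.
by rewrite /C (nablaE M_surface nu_normal nablaLC) // -!dotZl acceleration.
Qed.

(** B is the gradient of - r2 / 2. *)
Lemma centripetal_curl_free x : M x -> curl_free_at M B x.
Proof.
move=> Mx v w tv tw.
have sh : smooth_map M (fun y => (- 2^-1) * r2 y).
  by apply: smooth_mapM => //; exact: smooth_map_cst.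
apply: (hessian_sym M_surface nu_normal nablaLC sh) => // y a My ta.
rewrite (@dM_mul _ _ (fun=> - 2^-1)) //; last exact: smooth_map_cst.
rewrite dM_cst // mul0r add0r dM_r2 // (dot_tproj M_surface nu_normal) //.
lra.
Qed.

Lemma zonal_differentials_parallel x (h : 'rV[R]_3 -> R) Y v w : M x -> r2 x != 0 ->
  smooth_map M h -> tangent M x Y -> dM M h x (K x) = 0 -> dot Y (K x) = 0 ->
  tangent M x v -> tangent M x w ->
  dM M h x v * dot Y w = dM M h x w * dot Y v.
Proof.
move=> Mx r0 sh tY hK YK tv tw; have tKx := tK Mx.
apply: (@functionals_killing_vector_parallel _ (nu x) (K x) (dM M h x) (dot Y)) => //.
- exact: nu1.
- exact: (tP _ Mx).1.
- exact: (tP _ Mx).1.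
- exact: (tP _ Mx).1.
- move=> k a b /(tP _ Mx) ta /(tP _ Mx) tb.
  by rewrite !(grad_dM M_surface nu_normal) ?dotDr ?dotZr //; exact: (tangent_lin M_surface nu_normal).
- by move=> k a b _ _; rewrite dotDr dotZr.
Qed.

(** In the derivative of r2^2 C = s^2 B, the terms containing dr2 and ds are
products of parallel 1-forms and have no antisymmetric part; B has no curl. *)
Lemma accel_curl_free x : M x -> r2 x != 0 -> curl_free_at M C x.
Proof.
move=> Mx r0 v w tv tw; have tKx := tK Mx.
have tCx := tC Mx; have tBx := tB Mx.
have BK : dot (B x) (K x) = 0.
  by rewrite (dot_tproj M_surface nu_normal) // dotC dot_crossr.
have CK : dot (C x) (K x) = 0.
  have r20 : r2 x ^+ 2 != 0 by rewrite expf_neq0.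
  by apply: (mulfI r20); rewrite mulr0 -dotZl accelE // dotZl BK mulr0.
have s1 : smooth_map M (fun y => r2 y * r2 y) by exact: smooth_mapM.
have s2 : smooth_map M (fun y => s y * s y) by exact: smooth_mapM.
have E a : tangent M x a ->
  (dM M r2 x a * r2 x + r2 x * dM M r2 x a) *: C x + (r2 x * r2 x) *: dM M C x a =
  (dM M s x a * s x + s x * dM M s x a) *: B x + (s x * s x) *: dM M B x a.
  move=> ta; rewrite -!dM_mul // -!dM_scale //; apply: dM_congr => y My.
  by rewrite -!expr2 accelE.
have Ev := congr1 (fun z => dot z w) (E v tv).
have Ew := congr1 (fun z => dot z v) (E w tw).
rewrite [LHS]dotDl [RHS]dotDl !dotZl in Ev.
rewrite [LHS]dotDl [RHS]dotDl !dotZl in Ew.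
have W1 := zonal_differentials_parallel Mx r0 sr2 tCx (dM_r2_rotation Mx) CK tv tw.
have W2 := zonal_differentials_parallel Mx r0 ss tBx (dM_momentum_rotation Mx) BK tv tw.
have W3 := centripetal_curl_free Mx tv tw.
have r20 : r2 x * r2 x != 0 by rewrite mulf_neq0.
apply: (mulfI r20).
have P1 : (dM M r2 x v * r2 x + r2 x * dM M r2 x v) * dot (C x) w =
          (dM M r2 x w * r2 x + r2 x * dM M r2 x w) * dot (C x) v.
  by transitivity (2 * r2 x * (dM M r2 x v * dot (C x) w)); [ring | rewrite W1; ring].
have P2 : (dM M s x v * s x + s x * dM M s x v) * dot (B x) w =
          (dM M s x w * s x + s x * dM M s x w) * dot (B x) v.
  by transitivity (2 * s x * (dM M s x v * dot (B x) w)); [ring | rewrite W2; ring].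
by move: Ev Ew; rewrite P1 P2 W3; lra.
Qed.

Variable Omega : R.

(** What the gradient of the pressure has to be. *)
Definition pressure_gradient y := (Omega * chi nu y) *: rotJ nu y (u y) - nabla u y (u y).

Lemma coriolis x : M x -> rotJ nu x (u x) = - G x.
Proof.
move=> Mx; rewrite u_def // /rotJ triple_product nu1 // scale1r.
by rewrite (tP _ Mx).1 ?scale0r ?sub0r //; exact: tG.
Qed.

Lemma smooth_chi : smooth_map M (chi nu).
Proof. by apply: smooth_map_dot => //; exact: smooth_map_cst. Qed.
Let schi := smooth_chi.
Let sOchi : smooth_map M (fun y => Omega * chi nu y).
Proof. by apply: smooth_mapM => //; exact: smooth_map_cst. Qed.

Lemma pressure_gradient_field : vector_field M pressure_gradient.
Proof.
split.
  apply: smooth_mapB => //; apply: smooth_mapZ => //.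
  exact: smooth_map_cross.
move=> x Mx; apply: (tangentB M_surface nu_normal) => //; last exact: tC.
by apply: (tangentZ M_surface nu_normal) => //; exact: tangent_cross.
Qed.

(** The Coriolis term is - Omega chi G, with d chi parallel to df. *)
Lemma pressure_gradient_curl_free x : M x -> r2 x != 0 -> curl_free_at M pressure_gradient x.
Proof.
move=> Mx r0 v w tv tw.
pose h y := - (Omega * chi nu y).
have sh : smooth_map M h by exact: smooth_mapN.
have E a : tangent M x a -> dM M pressure_gradient x a = dM M h x a *: G x + h x *: dM M G x a - dM M C x a.
  move=> ta; rewrite -dM_scale // -dMB //; last exact: smooth_mapZ.
  by apply: dM_congr => y My; rewrite /pressure_gradient coriolis // scalerN scaleNr.
have hK : dM M h x (K x) = 0.
  have tKx := tK Mx.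
  rewrite dMN // (@dM_mul _ _ (fun=> Omega)) //; last exact: smooth_map_cst.
  by rewrite dM_cst // dM_chi_rotation // mul0r mulr0 addr0 oppr0.
have tGx := tG Mx.
have W1 := zonal_differentials_parallel Mx r0 sh tGx hK (dot_grad_rotation Mx) tv tw.
rewrite !E // !dotBl !dotDl !dotZl W1 (stream_grad_sym Mx tv tw).
by rewrite (accel_curl_free Mx r0 tv tw).
Qed.

End ZonalFlow.

(** * The curl at the poles *)

Section Poles.
Variable R : realType.

Lemma smooth_map_continuous (V W : normedModType R) (A : set V) (g : V -> W) x :
  smooth_map A g -> nbhs x A -> {for x, continuous g}.
Proof.
move=> sg nA; have Ax : A x by exact: nbhs_singleton.
have [U [F [oU Ux sF Fg]]] := sg _ Ax.
have nFg : \forall y \near x, F y = g y.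
  have nU : \forall y \near x, U y by exact: open_nbhs_nbhs.
  by apply: filterS2 nU nA => y Uy Ay; exact: Fg.
have dF := smooth_differentiable sF Ux.
by apply: differentiable_continuous; have [] := is_diff_near nFg dF.
Qed.

Lemma derive_neq0_punctured (g : R -> R) (a : R) : is_derive (0 : R) (1 : R) g a ->
  g 0 = 0 -> a != 0 -> \forall t \near (0 : R)^', g t != 0.
Proof.
move=> [dg Dg] g0 a0.
have cv : h^-1 *: (g (h *: 1 + 0) - g 0) @[h --> (0 : R)^'] --> a.
  by rewrite -Dg; exact: dg.
have oa : nbhs a [set z : R | z != 0] by apply: open_nbhs_nbhs; split => //; exact: open_neq.
have H : \forall t \near (0 : R)^', t^-1 *: (g (t *: 1 + 0) - g 0) != 0 by exact: cv _ oa.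
apply: filterS H => t /=.
rewrite g0 subr0 addr0 [t *: 1]mulr1; apply: contraNN => /eqP ->.
by rewrite scaler0.
Qed.

Variables (M : set 'rV[R]_3) (nu : 'rV[R]_3 -> 'rV[R]_3).
Hypotheses (M_surface : smooth_surface M) (nu_normal : outward_unit_normal M nu).

(** The tangent plane at a pole contains a vector that is not parallel to the
axis, and a curve with such an initial velocity leaves the axis at once. *)
Lemma leave_pole x : M x -> dot (rotation_field x) (rotation_field x) = 0 ->
  exists a c, curve_at M x a c /\
    \forall t \near (0 : R)^', dot (rotation_field (c t)) (rotation_field (c t)) != 0.
Proof.
move=> Mx; rewrite rotation_field_sqr => /eqP; rewrite paddr_eq0 ?sqr_ge0 // !sqrf_eq0.
move=> /andP[/eqP x0 /eqP x1].
have [a ta ha] : exists2 a, tangent M x a & a 0 0 != 0 \/ a 0 1 != 0.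
  (* nu x e3 has second coordinate - nu_0; if that is 0, then e1 is tangent. *)
  have [n0|n0] := eqVneq (nu x 0 0) 0; last first.
    exists (cross (nu x) (e3 R)); first exact: tangent_cross.
    by right; rewrite !crossE !vec3E mulr0 mulr1 sub0r oppr_eq0.
  exists (vec3 1 0 0); last by left; rewrite vec3E oner_eq0.
  apply/(tanP M_surface nu_normal) => //.
  by rewrite dot3E !vec3E n0 !mulr0 mul0r !addr0.
have [c cu] := ta; exists a, c; split=> //.
have [_ [c0 _]] := cu.
have dc := (is_derive_coordP _ _ _).1 (curve_is_derive cu).
have key i : a 0 i != 0 -> x 0 i = 0 -> \forall t \near (0 : R)^', c t 0 i != 0.
  by move=> ai xi; apply: derive_neq0_punctured (dc i) _ ai; rewrite c0.
case: ha => ai; [have := key _ ai x0 | have := key _ ai x1]; apply: filterS => t ct;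
  rewrite rotation_field_sqr paddr_eq0 ?sqr_ge0 // !sqrf_eq0 negb_and ct ?orbT //.
Qed.

(** Along a curve that leaves the pole, the antisymmetric part of D Y, evaluated
on the projections of v and w to the moving tangent plane, is a continuous
function of time that vanishes for small nonzero times. *)
Lemma curl_free_closure Y x : smooth_map M Y ->
  (forall y, M y -> dot (rotation_field y) (rotation_field y) != 0 -> curl_free_at M Y y) ->
  M x -> curl_free_at M Y x.
Proof.
move=> sY cf Mx v w tv tw.
have [r0|] := eqVneq (dot (rotation_field x) (rotation_field x)) 0; last by move=> r0; exact: cf.
have [a [c [cu pole]]] := leave_pole Mx r0.
have cc : c t @[t --> (0 : R)] --> x by exact: curve_cvg cu.
have [[I [oI I0 sc Mc]] [c0 _]] := cu.
have [U [F [oU Ux sF FY]]] := sY _ Mx.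
pose A := [set t | I t /\ U (c t)].
have nA : nbhs (0 : R) A.
  have nI : nbhs (0 : R) I by exact: open_nbhs_nbhs.
  have nU : \forall t \near (0 : R), U (c t) by apply: cc; exact: open_nbhs_nbhs.
  by apply: filterS2 nI nU => t It Ut; split.
have scA : smooth_map A c by apply: (smooth_smooth_map oI _ sc) => t [].
have snc : smooth_map A (nu \o c).
  apply: (@smooth_map_comp _ _ _ _ _ M) => //; last by case: nu_normal.
  by move=> t [It _]; exact: Mc.
have sD i : smooth_map A ((fun y => 'D_(delta_mx 0 i) F y) \o c).
  apply: (@smooth_map_comp _ _ _ _ _ U) => //; first by move=> t [].
  by apply: smooth_smooth_map oU _ (smooth_derive _ sF).
pose Z z t := tproj nu z (c t).
have sZ z : smooth_map A (Z z).
  have sz : smooth_map A (fun=> z) by exact: smooth_map_cst.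
  apply: smooth_mapB => //; apply: (@smooth_mapZ _ _ _ _ (fun t => dot z (nu (c t)))) => //.
  exact: smooth_map_dot.
(* D z t is the derivative of Y along Z z t at c t, written with the fixed
   directional derivatives of F so that its smoothness in t is visible. *)
pose D z t := \sum_(i < 3) Z z t 0 i *: 'D_(delta_mx 0 i) F (c t).
have sDD z : smooth_map A (D z).
  apply: (@smooth_map_sum _ _ _ _ _ (fun i t => Z z t 0 i *: 'D_(delta_mx 0 i) F (c t))) => i.
  exact: smooth_mapZ ((smooth_map_coordP _ _).1 (sZ z) i) (sD i).
pose kap t := dot (D v t) (Z w t) - dot (D w t) (Z v t).
have skap : smooth_map A kap by apply: smooth_mapB; exact: smooth_map_dot.
have DE z t : A t -> D z t = dM M Y (c t) (Z z t).
  move=> [It Ut]; have Mct := Mc _ It.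
  have dF := smooth_differentiable sF Ut.
  have tZ : tangent M (c t) (Z z t) by exact: tproj_tangent.
  rewrite (dM_ext (F := F) (U := U)) //.
  by rewrite derive_basis.
have kap0 : kap 0 = 0.
  apply/eqP/negPn/negP => k0.
  have ck : kap t @[t --> (0 : R)] --> kap 0 by exact: smooth_map_continuous skap nA.
  have n1 : nbhs (kap 0) [set z : R | z != 0].
    by apply: open_nbhs_nbhs; split => //; exact: open_neq.
  have n2 : \forall t \near (0 : R)^', kap t != 0.
    by apply: nbhs_dnbhs; exact: ck _ n1.
  have n3 : \forall t \near (0 : R)^', A t by apply: nbhs_dnbhs.
  have n4 : \forall t \near (0 : R)^',
      [/\ kap t != 0, A t & dot (rotation_field (c t)) (rotation_field (c t)) != 0].
    by apply: filterS3 n2 n3 pole => t ? ? ?; split.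
  have [t [kt At rt]] := @filter_ex _ _ (Proper_dnbhs_numFieldType (0 : R)) _ n4.
  have Mct := Mc _ At.1.
  move/eqP: kt; apply; rewrite /kap !DE //.
  rewrite (cf _ Mct rt) ?subrr //; exact: tproj_tangent.
have A0 : A 0 by exact: nbhs_singleton.
move: kap0; rewrite /kap !DE // /Z c0 !(tproj_id M_surface nu_normal) // => /eqP.
by rewrite subr_eq0 => /eqP.
Qed.

End Poles.

(** * Radial projection onto the sphere *)

Section RadialProjection.
Variables (R : realType) (n : nat).
Implicit Types y v : 'rV[R]_n.

Definition inv_norm (y : 'rV[R]_n) : R := (Num.sqrt (dot y y))^-1.

Lemma open_neq0_row : open [set y : 'rV[R]_n | y != 0].
Proof.
have -> : [set y : 'rV[R]_n | y != 0] = Num.norm @^-1` [set z : R | z != 0].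
  by rewrite eqEsubset; split=> y; rewrite /= normr_eq0.
by apply: open_comp; [move=> y _; exact: norm_continuous | exact: open_neq].
Qed.

(** The derivative of 1 / |y| is a polynomial in 1 / |y| and the coordinates, so
that smoothness follows by induction in [smooth_inv_norm]. *)
Lemma inv_norm_derive y v : y != 0 ->
  differentiable inv_norm y /\
  'D_v inv_norm y = - (inv_norm y * inv_norm y * inv_norm y) * dot y v.
Proof.
move=> y0; have q0 := dot_self_gt0 y0.
have sq0 : Num.sqrt (dot y y) != 0 by rewrite gt_eqF // sqrtr_gt0.
have dq : differentiable (fun y : 'rV[R]_n => dot y y) y.
  have : smooth_map setT (fun y : 'rV[R]_n => dot y y).
    by apply: smooth_map_dot; exact: smooth_map_id.
  by move=> /(smooth_map_open openT) /smooth_differentiable; exact.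
have dsq : differentiable (fun y : 'rV[R]_n => Num.sqrt (dot y y)) y.
  apply: (@differentiable_comp _ _ _ _ (fun y => dot y y) Num.sqrt) => //.
  by apply/derivable1_diffP; have [] := is_derive1_sqrt q0.
split; first exact: differentiableV.
rewrite deriveV //; last exact: diff_derivable.
have E0 : y + 0 *: v = y by rewrite scale0r addr0.
have dsq' : differentiable (fun y : 'rV[R]_n => Num.sqrt (dot y y)) (y + 0 *: v) by rewrite E0.
have [_ D1] := is_derive_along dsq'.
have H1 := is_derive_dot (is_derive_line y v 0) (is_derive_line y v 0).
have q0' : 0 < (fun s : R => dot (y + s *: v) (y + s *: v)) 0 by rewrite E0.
have [_ D2] := is_derive1_comp (is_derive1_sqrt q0') H1.
rewrite E0 in D1; rewrite -D1.
have -> : (fun s : R => Num.sqrt (dot (y + s *: v) (y + s *: v))) =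
  Num.sqrt \o (fun s : R => dot (y + s *: v) (y + s *: v)) by [].
rewrite D2 /= E0 /inv_norm [dot v y]dotC.
rewrite /GRing.scale /=.
field.
by rewrite sq0.
Qed.

Lemma smooth_inv_norm : smooth [set y : 'rV[R]_n | y != 0] inv_norm.
Proof.
have oO := open_neq0_row.
elim=> [|k IH].
  move=> y y0; apply: differentiable_continuous.
  by have [] := inv_norm_derive 0 y0.
split=> [y y0|v]; first by have [] := inv_norm_derive 0 y0.
apply: (@Ck_eq _ _ _ _ _ (fun y =>
  ((- 1) *: (inv_norm y *: (inv_norm y *: inv_norm y))) *: dot y v)) => //.
  move=> y y0; have [_ ->] := inv_norm_derive v y0.
  by rewrite /GRing.scale /=; ring.
apply: CkZ => //.
  apply: CkZ => //; first exact: Ck_cst.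
  by apply: CkZ => //; exact: CkZ.
have sd : smooth_map setT (fun y : 'rV[R]_n => dot y v).
  by apply: smooth_map_dot; [exact: smooth_map_id | exact: smooth_map_cst].
by apply: Ck_sub (smooth_map_open openT sd k).
Qed.

Definition to_sphere y := inv_norm y *: y.

Lemma smooth_to_sphere : smooth_map [set y : 'rV[R]_n | y != 0] to_sphere.
Proof.
apply: smooth_mapZ; last exact: smooth_map_id.
apply: smooth_smooth_map smooth_inv_norm => //; exact: open_neq0_row.
Qed.

Lemma dot_to_sphere y : y != 0 -> dot (to_sphere y) (to_sphere y) = 1.
Proof.
move=> y0; have q0 := dot_self_gt0 y0.
rewrite dotZl dotZr /inv_norm mulrA -invfM -expr2 sqr_sqrtr ?ltW //.
by rewrite mulVf // gt_eqF.
Qed.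

Lemma to_sphere_id y : dot y y = 1 -> to_sphere y = y.
Proof. by move=> y1; rewrite /to_sphere /inv_norm y1 sqrtr1 invr1 scale1r. Qed.

End RadialProjection.

(** * Curl-free fields on a sphere are gradients *)

Section Exactness.
Variables (R : realType) (M : set 'rV[R]_3).

(** The field beta represents the pullback of the 1-form <Y, .> by Phi, the radial
projection followed by the diffeomorphism onto M.  The symmetry of its
derivative combines that of D Y with that of the second derivative of Phi. *)
Lemma curl_free_exact (Y : 'rV[R]_3 -> 'rV[R]_3) :
  diffeomorphic M (@sphere2 R) -> smooth_map M Y ->
  (forall x, M x -> curl_free_at M Y x) ->
  exists2 p : 'rV[R]_3 -> R, smooth_map M p &
    forall x v, M x -> tangent M x v -> dM M p x v = dot (Y x) v.
Proof.
move=> [phi [psi [[sphi spsi] [phiS psiM] psiK phiK]]] sY cY.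
pose O := [set y : 'rV[R]_3 | y != 0].
have oO : open O by exact: open_neq0_row.
pose Phi := psi \o @to_sphere R 3.
have PhiM y : O y -> M (Phi y) by move=> y0; apply: psiM; exact: dot_to_sphere.
have sPhi' : smooth_map O Phi.
  apply: (@smooth_map_comp _ _ _ _ _ (@sphere2 R)) => //.
    by move=> y y0; exact: dot_to_sphere.
  exact: smooth_to_sphere.
have sPhi : smooth O Phi by exact: smooth_map_open.
have dPhi y : O y -> differentiable Phi y by exact: smooth_differentiable.
have sDPhi v : smooth_map O ('D_v Phi).
  by apply: (smooth_smooth_map oO _ (smooth_derive _ sPhi)).
have sYPhi : smooth_map O (Y \o Phi) by exact: (@smooth_map_comp _ _ _ _ _ M).
pose beta y : 'rV[R]_3 := \row_i dot (Y (Phi y)) ('D_(delta_mx 0 i) Phi y).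
have betaE y v : O y -> dot (beta y) v = dot (Y (Phi y)) ('D_v Phi y).
  move=> Oy; rewrite (derive_basis _ (dPhi _ Oy)) -[RHS]/(dotf (Y (Phi y)) _) linear_sum dotE.
  by apply: eq_bigr => i _; rewrite linearZ mxE mulrC.
have sbeta : smooth O beta.
  apply: smooth_map_open => //; apply/smooth_map_coordP => i.
  under eq_fun do rewrite mxE.
  by apply: (@smooth_map_dot _ _ _ _ (Y \o Phi)).
have line_curve y v : O y -> curve_at M (Phi y) ('D_v Phi y) (fun t => Phi (y + t *: v)).
  move=> Oy; have E0 : y + 0 *: v = y by rewrite scale0r addr0.
  have [oI sI] := smooth_line_comp y v oO sPhi.
  split.
    exists [set t : R | O (y + t *: v)]; split=> //; first by rewrite /= E0.
    by move=> t; exact: PhiM.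
  split; first by rewrite E0.
  have dP : differentiable Phi (y + 0 *: v) by rewrite E0; exact: dPhi.
  by rewrite derive1E; have [_ ->] := is_derive_along dP; rewrite E0.
have Dbeta y v w : O y -> dot ('D_v beta y) w =
    dot (dM M Y (Phi y) ('D_v Phi y)) ('D_w Phi y) +
    dot (Y (Phi y)) ('D_v ('D_w Phi) y).
  move=> Oy; have E0 : y + 0 *: v = y by rewrite scale0r addr0.
  have db : differentiable beta y by exact: smooth_differentiable sbeta Oy.
  have dDP : differentiable ('D_w Phi) y.
    by exact: smooth_differentiable (smooth_derive w sPhi) Oy.
  have [_ D1] := is_derive_dot (is_derive_along0 v db) (is_derive_cst w (0 : R) (1 : R)).
  have [_ D2] := is_derive_dot (dM_curve sY (PhiM _ Oy) (line_curve y v Oy))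
    (is_derive_along0 v dDP).
  have nO : \forall t \near (0 : R), O (y + t *: v).
    have [oI _] := smooth_line_comp y v oO sPhi.
    by apply: (open_nbhs_nbhs); split => //=; rewrite E0.
  have nE : \forall t \near (0 : R), dot (beta (y + t *: v)) w =
      dot (Y (Phi (y + t *: v))) ('D_w Phi (y + t *: v)).
    by apply: filterS nO => t; exact: betaE.
  have D3 := near_eq_derive (1 : R) nE.
  have D4 := etrans (esym D1) (etrans D3 D2).
  rewrite dot0r addr0 in D4; apply: etrans D4 _.
  exact: (congr2 +%R
    (congr1 (fun z => dot (dM M Y (Phi y) ('D_v Phi y)) ('D_w Phi z)) E0)
    (congr1 (fun z => dot (Y (Phi z)) ('D_v ('D_w Phi) y)) E0)).
have cbeta y v w : y != 0 -> dot ('D_v beta y) w = dot ('D_w beta y) v.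
  move=> Oy; apply: etrans (Dbeta y v w Oy) _; apply: etrans (esym (Dbeta y w v Oy)).
  have tPhi a : tangent M (Phi y) ('D_a Phi y).
    by exists (fun t => Phi (y + t *: a)); exact: line_curve.
  have sch := schwarz v w oO Oy (sPhi 2%N).
  exact: (congr2 +%R (cY _ (PhiM _ Oy) _ _ (tPhi v) (tPhi w)) (congr1 (dot _) (esym sch))).
have [P HP] := poincare_punctured sbeta cbeta.
have sP : smooth O P.
  case=> [|k] /=.
    by move=> y Oy; apply: differentiable_continuous; have [] := HP y Oy.
  split=> [y Oy|v]; first by have [] := HP y Oy.
  apply: (@Ck_eq _ _ _ _ _ (fun y => dot (beta y) v)) => //.
    by move=> y Oy; have [_ ->] := HP y Oy.
  apply: (smooth_map_open oO); apply: smooth_map_dot; last exact: smooth_map_cst.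
  exact: smooth_smooth_map sbeta.
have phiO x : M x -> O (phi x).
  move=> Mx; apply/eqP => E; have := phiS _ Mx.
  by rewrite /sphere2 /= E dot0l => /eqP; rewrite eq_sym oner_eq0.
have PhiK x : M x -> Phi (phi x) = x.
  by move=> Mx; rewrite /Phi /= to_sphere_id ?psiK //; exact: phiS.
have sp : smooth_map M (P \o phi).
  apply: (@smooth_map_comp _ _ _ _ _ O) => //.
  exact: smooth_smooth_map sP.
exists (P \o phi) => // x v Mx [c cu].
have [_ [c0 _]] := cu.
apply: (dM_unique sp Mx cu).
have dphi := dM_curve sphi Mx cu.
set D := dM M phi x v in dphi.
have dP : differentiable P ((phi \o c) 0) by rewrite /= c0; have [] := HP _ (phiO _ Mx).
have H1 := is_derive_diff_comp dphi dP.
have dPhi0 : differentiable Phi ((phi \o c) 0) by rewrite /= c0; exact: dPhi (phiO _ Mx).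
have [_ H2] := is_derive_diff_comp dphi dPhi0.
have vE : 'D_D Phi (phi x) = v.
  have [_ <-] := curve_is_derive cu.
  rewrite /= c0 in H2; rewrite -H2; apply: near_eq_derive.
  by apply: filterS (curve_near cu) => t Mt; rewrite /= PhiK.
apply: is_derive_eq H1 _; rewrite /= c0.
apply: etrans ((HP _ (phiO _ Mx)).2 D) (etrans (betaE _ D (phiO _ Mx)) _).
have Q := congr2 (@dot R 3) (congr1 Y (PhiK _ Mx)) vE.
exact: Q.
Qed.

End Exactness.

Theorem proposition3p1p1 (R : realType) (M : set 'rV[R]_3)
    (nu : 'rV[R]_3 -> 'rV[R]_3)
    (nabla : ('rV[R]_3 -> 'rV[R]_3) -> 'rV[R]_3 -> 'rV[R]_3 -> 'rV[R]_3)
    (f : 'rV[R]_3 -> R) (u : 'rV[R]_3 -> 'rV[R]_3)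
    (M_surface : smooth_surface M)
    (M_compact : compact M)
    (M_sphere : diffeomorphic M (@sphere2 R))
    (nu_normal : outward_unit_normal M nu)
    (M_curved : forall x, M x -> 0 < gauss_curvature M nu x)
    (M_radial : radially_symmetric M)
    (nablaLC : levi_civita M nabla)
    (f_smooth : smooth_map M f)
    (f_zonal : zonal M f)
    (u_def : forall x, M x -> u x = rotJ nu x (grad M f x)) :
  (forall x, M x -> divergence M nabla u x = 0) /\
  (forall Omega : R, exists p : 'rV[R]_3 -> R,
     smooth_map M p /\
     forall x, M x ->
       nabla u x (u x) = (Omega * chi nu x) *: rotJ nu x (u x) - grad M p x).
Proof.
split=> [x Mx|Omega].
  exact: (divergence_stream M_surface nu_normal nablaLC f_smooth u_def).
have vW := pressure_gradient_field M_surface nu_normal nablaLC f_smooth u_def Omega.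
have cW x : M x -> curl_free_at M (pressure_gradient nu nabla u Omega) x.
  apply: (curl_free_closure M_surface nu_normal vW.1) => y My r0.
  exact: (pressure_gradient_curl_free M_surface nu_normal nablaLC f_smooth u_def M_radial f_zonal).
have [p sp Hp] := curl_free_exact M_sphere vW.1 cW.
exists p; split=> // x Mx.
rewrite (grad_eq M_surface nu_normal (w := pressure_gradient nu nabla u Omega x)) //.
- by rewrite /pressure_gradient opprB addrCA subrr addr0.
- exact: vW.2.
- by move=> v tv; rewrite Hp.
Qed.
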